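(* Let $G$ be any graph and let $C_1,C_2\subseteq G$ be two different circles. Then there exist a Cantor set $B$, a minimal continuous map $f:B\to B$, a connected graph $\Gamma$, a continuous map $F:B\times\Gamma\to B\times\Gamma$ with $\mathrm{pr}_1\circ F=f\circ\mathrm{pr}_1$, a minimal set $M$ of $F$ and a point $b\in B$ such that $M_z=M\cap(\{z\}\times\Gamma)$ is a circle for each $z\ne b$, and $M_b$ is a union of two circles homeomorphic to $C_1\cup C_2$. In particular, there exist such systems for which $M_b$ is a union of two disjoint circles.
   Context: A graph is a nonempty compact metric space that is a union of finitely many arcs, any two of which are disjoint or meet only in one or both of their end-points. A circle is a simple closed curve. A continuous selfmap of a compact metric space is minimal if it has no proper nonempty closed invariant subset; a minimal set of $F$ is a nonempty closed set $M$ with $F(M)\subseteq M$ on which $F$ is minimal. *)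

(* Defs.v *)
From HB Require Import structures.
From mathcomp Require Import all_boot all_order all_algebra.
From mathcomp Require Import all_classical all_reals all_analysis.
Set Implicit Arguments. Unset Strict Implicit. Unset Printing Implicit Defensive.
Import Order.TTheory GRing.Theory Num.Theory.
Import numFieldTopology.Exports.
Local Open Scope classical_set_scope.
Local Open Scope ring_scope.

Definition homeo (X Y : topologicalType) (A : set X) (B : set Y)
  (f : X -> Y) (g : Y -> X) : Prop :=
  {within A, continuous f} /\ {within B, continuous g} /\
  f @` A `<=` B /\ g @` B `<=` A /\
  (forall x, A x -> g (f x) = x) /\
  (forall y, B y -> f (g y) = y).

Definition homeomorphic (X Y : topologicalType) (A : set X) (B : set Y) : Prop :=
  exists f g, homeo A B f g.

Definition unit_circle (R : realType) : set (R * R)%type :=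
  [set p | p.1 ^+ 2 + p.2 ^+ 2 = 1].

Definition is_circle (R : realType) (X : topologicalType) (C : set X) : Prop :=
  homeomorphic (@unit_circle R) C.

Definition unit_interval (R : realType) : set R := `[0%R, 1%R].

Definition is_arc_param (R : realType) (X : topologicalType) (a : R -> X) : Prop :=
  exists g, homeo (@unit_interval R) (a @` @unit_interval R) a g.

Definition arc_endpoints (R : realType) (X : topologicalType) (a : R -> X) : set X :=
  [set a 0%R; a 1%R].

Definition is_graph (R : realType) (X : pseudoMetricType R) : Prop :=
  [/\ hausdorff_space X, compact [set: X], [set: X] !=set0 &
  exists (n : nat) (arcs : 'I_n -> R -> X),
    [/\ (forall i, is_arc_param (arcs i)),
        [set: X] = \bigcup_(i in [set: 'I_n]) (arcs i @` @unit_interval R) &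
        (forall i j, i <> j ->
           (arcs i @` @unit_interval R) `&` (arcs j @` @unit_interval R)
           `<=` arc_endpoints (arcs i) `&` arc_endpoints (arcs j))]].

Definition minimal_on (X : topologicalType) (F : X -> X) (A : set X) : Prop :=
  forall N, N `<=` A -> N !=set0 -> closed N -> F @` N `<=` N -> N = A.

Definition minimal_map (X : topologicalType) (f : X -> X) : Prop :=
  continuous f /\ minimal_on f [set: X].

Definition minimal_set (X : topologicalType) (F : X -> X) (M : set X) : Prop :=
  [/\ M !=set0, closed M, F @` M `<=` M & minimal_on F M].

Definition is_cantor_set (X : topologicalType) : Prop :=
  homeomorphic [set: X] [set: cantor_space].

Definition fibre (B G : topologicalType) (M : set (B * G)%type) (z : B) : set (B * G)%type :=
  [set p | M p /\ p.1 = z].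

Definition skew_system_exists (R : realType)
  (P : forall (B G : pseudoMetricType R), set (B * G)%type -> Prop) : Prop :=
  exists (B G : pseudoMetricType R) (f : B -> B) (F : (B * G)%type -> (B * G)%type)
         (M : set (B * G)%type) (b : B),
    is_cantor_set B /\ minimal_map f /\ is_graph G /\ connected [set: G] /\
    continuous F /\ fst \o F = f \o fst /\ minimal_set F M /\
    (forall z, z <> b -> is_circle R (fibre M z)) /\
    P B G (fibre M b).

(* Main.v *)
(** Let tau be the dyadic odometer. Doubling the points of the backward orbit of 0 gives a
    minimal map f on a Cantor set B which is injective except that a single point b has two
    preimages, and these lie in different pieces of a clopen partition P_1, P_2 of B. So
    f(P_1) and f(P_2) are closed sets with only b in common, and
    M = f(P_1) x C_1 \cup f(P_2) x C_2 has the required fibres. With circle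
    parametrizations g_j of C_j, the map q(z, x) = (f z, g_j x) for z in P_j sends B x R
    onto M, and one looks for F with F(q(z, x)) = q(f z, T_c x), where c is the point of the
    odometer under z and T_c lifts a circle map of degree one. Two points of P_1 and P_2
    over c = 0 have the same image b, so F is well defined there only if T_0 is constant on
    the parts of the two circles that can meet. Since C_1 <> C_2, each C_j contains an arc
    that is open in the graph and misses the other circle, and it suffices that T_0 is flat
    off the parameter interval of this arc.

    Such maps T_c come from a Denjoy type construction: in the minimal system tau x rotation
    by alpha the backward orbit of (0, 0) is blown up to intervals. The inverse of the
    semiconjugacy psi_c is the multivalued map
    Phi_c(t) = \sum_n 2^(-n-1) (K_{tau^n c}(t + n alpha) - n alpha), where K_c is a
    homeomorphism of the line that degenerates to a staircase as c tends to 0. From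
    Phi_c(t) = K_c(t)/2 + (Phi_{tau c}(t + alpha) - alpha)/2 one gets
    T_c(x) = 2x + alpha - K_c(psi_c x). As psi_c is injective for a dense set of c, minimality
    of tau x rotation passes to M.

    The extension of F from M to the whole product splits off the degree one part, which is
    the map of the graph to the circle collapsing everything outside the two open arcs; the
    remaining real valued part is extended by Tietze's theorem. If C_1 meets C_2, the graph
    is the component containing them, and otherwise it is a dumbbell in the plane. *)
Require Import Defs.
From HB Require Import structures.
From mathcomp Require Import all_boot all_order all_algebra.
From mathcomp Require Import all_classical all_reals all_analysis.
From mathcomp Require Import lra ring zify.
Set Implicit Arguments. Unset Strict Implicit. Unset Printing Implicit Defensive.
Import Order.TTheory GRing.Theory Num.Theory.
Import numFieldTopology.Exports.
Local Open Scope classical_set_scope.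
Local Open Scope ring_scope.

(** * Topological preliminaries *)

Lemma cluster_continuous (X Y : topologicalType) (f : X -> Y) p q :
  continuous f -> cluster (nbhs p) q -> cluster (nbhs (f p)) (f q).
Proof.
move=> cf pq A B nA nB; have [x [Ax Bx]] := pq _ _ (cf p _ nA) (cf q _ nB).
by exists (f x).
Qed.

Lemma hausdorff_prod (X Y : topologicalType) :
  hausdorff_space X -> hausdorff_space Y -> hausdorff_space (X * Y)%type.
Proof.
move=> hX hY [x y] [x' y'] cl; congr pair.
  by apply: hX; apply: (@cluster_continuous _ _ fst (x, y) (x', y')) => // ?; exact: cvg_fst.
by apply: hY; apply: (@cluster_continuous _ _ snd (x, y) (x', y')) => // ?; exact: cvg_snd.
Qed.

Lemma continuous_pair (X Y Z : topologicalType) (f : X -> Y) (g : X -> Z) :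
  continuous f -> continuous g -> continuous (fun x => (f x, g x)).
Proof. by move=> cf cg x; apply: cvg_pair; [exact: cf|exact: cg]. Qed.

(** On a compact [K] with Hausdorff target, [q] is a closed map: a closed set pulled back along [g]
    has a compact trace on [K], whose image under [q] is compact, hence closed. This is how maps
    given by a formula in parameters are shown continuous. *)
Lemma compact_descent (X Y Z : topologicalType) (K : set X) (q : X -> Y)
    (g : X -> Z) (h : Y -> Z) :
  hausdorff_space Y -> compact K -> {within K, continuous q} ->
  {within K, continuous g} -> (forall x, K x -> h (q x) = g x) ->
  {within q @` K, continuous h}.
Proof.
move=> hY cK cq cg hq; apply/continuous_closedP => C cC.
case/continuous_closedP/(_ _ cC)/closed_subspaceP : cg => V cV VE.
apply/closed_subspaceP; exists (q @` (K `&` V)).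
  apply: compact_closed => //; apply: continuous_compact.
    by apply: continuous_subspaceW cq => x [].
  exact: compact_closedI.
apply/seteqP; split=> y.
  move=> [[x [Kx Vx] <-] _]; split; last by exists x.
  have : (V `&` K) x by [].
  by rewrite VE => -[+ _]; rewrite /= /from_subspace hq.
move=> [/= Ch [x Kx xy]]; split; last by exists x.
exists x => //; split=> //.
have : (g @^-1` C `&` K) x by split => //=; rewrite /from_subspace -hq// xy.
by rewrite -VE => -[].
Qed.

Lemma compact_inj_homeo (X Y : topologicalType) (x0 : X) (K : set X) (f : X -> Y) :
  hausdorff_space Y -> compact K -> {within K, continuous f} ->
  {in K &, injective f} -> exists g, homeo K (f @` K) f g.
Proof.
move=> hY cK cf fi.
(* Off the image of [K] the inverse takes the default value [x0]. *)
pose g y := if pselect (exists x, K x /\ f x = y) is left h then projT1 (cid h) else x0.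
have gK x : K x -> g (f x) = x.
  move=> Kx; rewrite /g; case: pselect => [h|[]]; last by exists x.
  by case: cid => x' [Kx' ff'] /=; apply: fi => //; rewrite inE.
exists g; split=> //; split.
  apply: (@compact_descent _ _ _ K f id) => //.
  by apply: continuous_subspaceT => ?; exact: cvg_id.
split=> //; split; first by move=> _ [_ [x Kx <-] <-]; rewrite gK.
by split=> // _ [x Kx <-]; rewrite gK.
Qed.

Lemma continuous_comp_within (X Y Z : topologicalType) (A : set Y) (g : X -> Y)
    (f : Y -> Z) :
  continuous g -> (forall x, A (g x)) -> {within A, continuous f} ->
  continuous (f \o g).
Proof.
move=> cg Ag /subspace_continuousP cf x.
have := cf (g x) (Ag x); apply: cvg_comp => U; rewrite /within /= => nU.
have H : nbhs x (g @^-1` [set y | A y -> U y]) := cg x _ nU.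
by apply: (@filterS _ (nbhs x) _ _ _ _ H) => y; apply; exact: Ag.
Qed.

Lemma within_comp (X Y Z : topologicalType) (A : set X) (B : set Y) (g : X -> Y)
    (f : Y -> Z) :
  {within A, continuous g} -> (forall x, A x -> B (g x)) ->
  {within B, continuous f} -> {within A, continuous (f \o g)}.
Proof.
move=> /subspace_continuousP cg Ag /subspace_continuousP cf.
apply/subspace_continuousP => x Ax.
have := cf (g x) (Ag x Ax); apply: cvg_comp => U; rewrite /within /= => nU.
have H : nbhs x [set y | A y -> B (g y) -> U (g y)] := cg x Ax _ nU.
by apply: (@filterS _ (nbhs x) _ _ _ _ H) => y + Ay; apply => //; exact: Ag.
Qed.

Lemma near_fst (X Y : topologicalType) (x : X) (y : Y) (P : set X) :
  (\forall x' \near x, P x') -> \forall p \near (x, y), P p.1.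
Proof.
by move=> H; exists (P, setT) => [|p []] //; split=> //; exact: filterT.
Qed.

Lemma near_snd (X Y : topologicalType) (x : X) (y : Y) (P : set Y) :
  (\forall y' \near y, P y') -> \forall p \near (x, y), P p.2.
Proof.
by move=> H; exists (setT, P) => [|p []] //; split=> //; exact: filterT.
Qed.

Lemma closed_preimage (X Y : topologicalType) (f : X -> Y) (A : set Y) :
  continuous f -> closed A -> closed (f @^-1` A).
Proof. by move=> /continuous_closedP; apply. Qed.

Section real_valued.
Context {R : realType} {X : topologicalType}.
Implicit Types f g : X -> R.

Lemma continuousD_fun f g : continuous f -> continuous g -> continuous (fun x => f x + g x).
Proof. by move=> cf cg x; apply: cvgD; [exact: cf|exact: cg]. Qed.

Lemma continuousB_fun f g : continuous f -> continuous g -> continuous (fun x => f x - g x).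
Proof. by move=> cf cg x; apply: cvgB; [exact: cf|exact: cg]. Qed.

Lemma continuousM_fun f g : continuous f -> continuous g -> continuous (fun x => f x * g x).
Proof. by move=> cf cg x; apply: cvgM; [exact: cf|exact: cg]. Qed.

Lemma continuous_max_fun f g :
  continuous f -> continuous g -> continuous (fun x => Num.max (f x) (g x)).
Proof. by move=> cf cg x; apply: (@continuous_max R X f g); [exact: cf|exact: cg]. Qed.

Lemma continuous_min_fun f g :
  continuous f -> continuous g -> continuous (fun x => Num.min (f x) (g x)).
Proof. by move=> cf cg x; apply: (@continuous_min R X f g); [exact: cf|exact: cg]. Qed.
End real_valued.

Lemma continuous_cst (X Y : topologicalType) (y : Y) : continuous (fun _ : X => y).
Proof. by move=> x; exact: cvg_cst. Qed.

Lemma continuous_idfun (X : topologicalType) : continuous (fun x : X => x).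
Proof. by move=> x; exact: cvg_id. Qed.

Lemma continuous_compose (X Y Z : topologicalType) (f : X -> Y) (g : Y -> Z) :
  continuous f -> continuous g -> continuous (fun x => g (f x)).
Proof. by move=> cf cg x; apply: continuous_comp; [exact: cf|exact: cg]. Qed.

Lemma equivariant_int (R : realType) (f : R -> R) (k : int) x :
  (forall x, f (x + 1) = f x + 1) -> f (x + k%:~R) = f x + k%:~R.
Proof.
move=> fD; suff H (n : nat) u : f (u + n%:R) = f u + n%:R.
  case: k => n; first exact: H.
  by rewrite NegzE mulrNz; have := H n.+1 (x - n.+1%:R); rewrite subrK => ->; ring.
elim: n => [|n IH]; first by rewrite !addr0.
by rewrite -natr1 !addrA fD IH.
Qed.

(** * Circles as quotients of the line by the integers *)

Section circle.
Context {R : realType}.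

(** Circles are handled through maps of the line whose fibres are exactly the cosets of the
    integers, so that circle maps can be given by real-valued lifts. *)
Definition circle_param (X : topologicalType) (C : set X) (g : R -> X) :=
  [/\ continuous g, (forall t s, g t = g s <-> exists k : int, t = s + k%:~R) &
      C = range g].

Definition wind (t : R) : R * R := (cos (2 * pi * t), sin (2 * pi * t)).

Lemma floor_frac (x : R) : exists k : int, 0 <= x - k%:~R < 1.
Proof.
by exists (Num.floor x); have := floor_le x; have := floorD1_gt x; rewrite intrD; lra.
Qed.

Lemma continuous_wind : continuous wind.
Proof.
have cl : continuous (fun t : R => 2 * pi * t).
  by apply: continuousM_fun; [exact: continuous_cst|exact: continuous_idfun].
by apply: continuous_pair; apply: continuous_compose cl _;
  [exact: continuous_cos|exact: continuous_sin].
Qed.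

Lemma wind_period (t : R) (k : int) : wind (t + k%:~R) = wind t.
Proof.
suff H (n : nat) s : wind (s + n%:R) = wind s.
  case: k => n; first exact: H.
  by rewrite NegzE -(H n.+1) mulrNz -addrA addNr addr0.
elim: n => [|n IH]; first by rewrite addr0.
rewrite -natr1 addrA -IH /wind; congr pair.
  by rewrite mulrDr mulr1 mulr_natl cosD2pi.
by rewrite mulrDr mulr1 mulr_natl sinD2pi.
Qed.

(** With [u] the fractional part of [t - s], the angle [2 * pi * u] has cosine 1. Injectivity of the
    cosine on [0, pi] gives [u = 0] when [u <= 1 / 2]; otherwise, applied to [1 - u], it would give
    [u = 1], which is excluded. *)
Lemma wind_eq (t s : R) : wind t = wind s <-> exists k : int, t = s + k%:~R.
Proof.
split=> [|[k ->]]; last exact: wind_period.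
move=> [ct st].
have [k /andP[k0 k1]] := floor_frac (t - s).
set u := t - s - k%:~R in k0 k1.
have cu : cos (2 * pi * u) = 1.
  have -> : cos (2 * pi * u) = cos (2 * pi * (t - s)).
    by have [<- _] := wind_period u k; rewrite /u addrNK.
  by rewrite mulrBr cosB ct st -!expr2 cos2Dsin2.
exists k; suff : u = 0 by rewrite /u; lra.
have pi0 := pi_gt0 R.
have [uh|uh] := leP u (1 / 2).
  have := @cos_inj R (2 * pi * u) 0; rewrite !in_itv/= cu cos0 => H.
  have : 2 * pi * u = 0 by apply: H => //; nra.
  by move/eqP; rewrite !mulf_eq0 pnatr_eq0/= (gt_eqF pi0) /= => /eqP.
have c1 : cos (2 * pi * (1 - u)) = 1.
  have [<- _] := wind_period (1 - u) (- 1).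
  by rewrite -[RHS]cu -[RHS]cosN; congr cos; rewrite mulrN1z; ring.
have := @cos_inj R (2 * pi * (1 - u)) 0; rewrite !in_itv/= c1 cos0 => H.
have : 2 * pi * (1 - u) = 0 by apply: H => //; nra.
move/eqP; rewrite !mulf_eq0 pnatr_eq0/= (gt_eqF pi0) /= => /eqP; lra.
Qed.

Lemma wind_range : @unit_circle R = range wind.
Proof.
apply/seteqP; split=> [[x y]|_ [t _ <-]]; last by rewrite /unit_circle /= cos2Dsin2.
rewrite /unit_circle /= => xy.
have x1 : -1 <= x <= 1 by nra.
have pi0 := pi_gt0 R.
have key u : cos u = x -> sin u = y -> range wind (x, y).
  move=> cu su; exists (u / (2 * pi)) => //.
  by rewrite /wind mulrC divfK ?cu ?su// mulf_neq0// ?pnatr_eq0// gt_eqF.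
have ca : cos (acos x) = x by apply: acosK; rewrite in_itv.
have sa : sin (acos x) = `|y|.
  by rewrite sin_acos// (_ : 1 - x ^+ 2 = y ^+ 2) ?sqrtr_sqr//; lra.
have [y0|y0] := leP 0 y; first by apply: (key (acos x)); rewrite // sa ger0_norm.
by apply: (key (- acos x)); rewrite ?cosN// sinN sa ltr0_norm// opprK.
Qed.

Lemma circle_param_wind : circle_param (@unit_circle R) wind.
Proof. by split; [exact: continuous_wind|exact: wind_eq|exact: wind_range]. Qed.

Lemma circle_param_exists (X : topologicalType) (C : set X) :
  is_circle R C -> exists g, circle_param C g.
Proof.
move=> [f [g [cf [cg [fC [gC [gf fg]]]]]]].
have uw t : (@unit_circle R) (wind t) by rewrite wind_range; exists t.
exists (f \o wind); split.
- exact: continuous_comp_within continuous_wind uw cf.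
- move=> t s; rewrite -wind_eq /=; split=> [|->//].
  by move/(congr1 g); rewrite !gf.
- apply/seteqP; split=> [y Cy|_ [t _ <-]]; last by apply: fC; exists (wind t).
  have : (@unit_circle R) (g y) by apply: gC; exists y.
  by rewrite wind_range => -[t _ tg]; exists t => //=; rewrite tg fg.
Qed.

Lemma circle_param_itv (X : topologicalType) (C : set X) g (a : R) :
  circle_param C g -> C = g @` `[a, a + 1].
Proof.
move=> [_ gE ->]; apply/seteqP; split=> [_ [t _ <-]|_ [t _ <-]]; last by exists t.
have [k k01] := floor_frac (t - a).
exists (t - k%:~R); first by rewrite /= in_itv/=; lra.
by apply/gE; exists (- k); rewrite mulrNz.
Qed.

Lemma circle_param_compact (X : topologicalType) (C : set X) g :
  circle_param C g -> compact C.
Proof.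
move=> gC; rewrite (circle_param_itv 0 gC); apply: continuous_compact.
  by apply: continuous_subspaceT; case: gC.
exact: segment_compact.
Qed.

Lemma circle_param_connected (X : topologicalType) (C : set X) g :
  circle_param C g -> connected C.
Proof.
move=> gC; rewrite (circle_param_itv 0 gC).
apply: connected_continuous_connected.
  exact/connected_intervalP/interval_is_interval.
by apply: continuous_subspaceT; case: gC.
Qed.

(** Since [g] and [h] identify the same parameters, [g t |-> h t] is a well-defined bijection; both
    directions are continuous by descent from a compact interval. *)
Lemma circle_params_homeomorphic (X Y : topologicalType) (C : set X) (D : set Y) g h :
  hausdorff_space X -> hausdorff_space Y ->
  circle_param C g -> circle_param D h -> homeomorphic C D.
Proof.
move=> hX hY gC hD.
have [cg gE Cg] := gC; have [ch hE Dh] := hD.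
pose f x := if pselect (exists t, g t = x) is left p then h (projT1 (cid p)) else h 0.
pose f' y := if pselect (exists t, h t = y) is left p then g (projT1 (cid p)) else g 0.
have fg t : f (g t) = h t.
  rewrite /f; case: pselect => [p|[]]; last by exists t.
  by case: cid => s /= /gE st; apply/hE.
have fh t : f' (h t) = g t.
  rewrite /f'; case: pselect => [p|[]]; last by exists t.
  by case: cid => s /= /hE st; apply/gE.
exists f, f'; split.
  rewrite (circle_param_itv 0 gC); apply: (@compact_descent _ _ _ _ _ h) => //.
  - exact: segment_compact.
  - exact: continuous_subspaceT.
  - exact: continuous_subspaceT.
split.
  rewrite (circle_param_itv 0 hD); apply: (@compact_descent _ _ _ _ _ g) => //.
  - exact: segment_compact.
  - exact: continuous_subspaceT.
  - exact: continuous_subspaceT.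
rewrite Cg Dh; split; first by move=> _ [_ [t _ <-] <-]; rewrite fg.
split; first by move=> _ [_ [t _ <-] <-]; rewrite fh.
by split=> _ [t _ <-]; rewrite ?fg ?fh.
Qed.

Lemma circle_param_is_circle (X : topologicalType) (C : set X) g :
  hausdorff_space X -> circle_param C g -> is_circle R C.
Proof.
move=> hX gC; apply: circle_params_homeomorphic circle_param_wind gC => //.
Qed.
End circle.

(** * Staircase functions *)

Section dyadic_average.
Context {R : realType}.
Implicit Types a : nat -> R.

Definition dyadic_sum a (N : nat) : R := \sum_(n < N) a n / 2 ^+ n.+1.
Definition dyadic_average a : R := limn (dyadic_sum a).

Lemma dyadic_sumS a N : dyadic_sum a N.+1 = a 0%N / 2 + dyadic_sum (a \o S) N / 2.
Proof.
rewrite /dyadic_sum big_ord_recl expr1; congr (_ + _).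
rewrite mulr_suml; apply: eq_bigr => i _ /=.
by rewrite /bump /= add1n [2 ^+ i.+2]exprSr invfM mulrA.
Qed.

Lemma dyadic_sum_bound a N :
  (forall n, 0 <= a n <= 1) -> 0 <= dyadic_sum a N <= 1.
Proof.
elim: N a => [|N IH] a a01; first by rewrite /dyadic_sum big_ord0 lexx ler01.
have := IH (a \o S) (fun n => a01 n.+1); have := a01 0%N.
by rewrite dyadic_sumS; lra.
Qed.

Lemma is_cvg_dyadic_sum a : (forall n, 0 <= a n <= 1) -> cvgn (dyadic_sum a).
Proof.
move=> a01; apply: nondecreasing_is_cvgn.
  apply/nondecreasing_seqP => n; rewrite /dyadic_sum big_ord_recr /= lerDl.
  by apply: divr_ge0; [case/andP: (a01 n)|exact: exprn_ge0].
by exists 1 => _ [N _ <-]; case/andP: (dyadic_sum_bound N a01).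
Qed.

Lemma dyadic_average_bound a :
  (forall n, 0 <= a n <= 1) -> 0 <= dyadic_average a <= 1.
Proof.
move=> a01; have ca := is_cvg_dyadic_sum a01; apply/andP; split.
  by apply: limr_ge => //; apply: nearW => N; case/andP: (dyadic_sum_bound N a01).
by apply: limr_le => //; apply: nearW => N; case/andP: (dyadic_sum_bound N a01).
Qed.

(** Limit of the finite recursion [dyadic_sumS], both sides of which converge because the partial
    sums are monotone and bounded. *)
Lemma dyadic_averageS a : (forall n, 0 <= a n <= 1) ->
  dyadic_average a = a 0%N / 2 + dyadic_average (a \o S) / 2.
Proof.
move=> a01; have ca := is_cvg_dyadic_sum a01.
have ca' := @is_cvg_dyadic_sum (a \o S) (fun n => a01 n.+1).
apply: (@cvg_unique R (@Rhausdorff R) (dyadic_sum (a) n.+1 @[n --> \oo])).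
  by move: ca; rewrite -cvg_shiftS.
rewrite (_ : (fun n => dyadic_sum a n.+1) =
   (fun n => a 0%N / 2 + dyadic_sum (a \o S) n / 2)); last first.
  by apply/funext => n; rewrite dyadic_sumS.
apply: cvgD; first exact: cvg_cst.
by apply: cvgM; [exact: ca'|exact: cvg_cst].
Qed.
End dyadic_average.

Section staircase.
Context {R : realType}.

Definition stair_width (v : nat) : R := v.+2%:R^-1.

(* Homeomorphisms of the line commuting with translation by 1. As [v] tends to infinity
   their graphs converge to the staircase whose jumps are the vertical segments
   between [stair_bot] and [stair_top] over the integers. *)
Definition staircase (v : nat) (t : R) : R :=
  let w := stair_width v in
  let k : R := (Num.floor t)%:~R in
  w * t + (1 - w) * (k + Num.min 1 ((t - k) / w)).

Definition stair_top (t : R) : R := (Num.floor t)%:~R + 1.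
Definition stair_bot (t : R) : R := (Num.ceil t)%:~R.

Lemma stair_width_gt0 v : 0 < stair_width v.
Proof. by rewrite invr_gt0. Qed.

Lemma stair_width_le v : stair_width v <= 2^-1.
Proof. by rewrite lef_pV2 ?posrE// ler_nat. Qed.

Lemma floorD1 (t : R) : Num.floor (t + 1) = Num.floor t + 1.
Proof. by rewrite (floorDrz t (intr_int _ 1)) floor1. Qed.

Lemma ceilD1 (t : R) : Num.ceil (t + 1) = Num.ceil t + 1.
Proof. by rewrite (ceilDrz t (intr_int _ 1)) ceil1. Qed.

Lemma floor_bounds (t : R) : (Num.floor t)%:~R <= t < (Num.floor t)%:~R + 1.
Proof. by have := floor_le t; have := floorD1_gt t; rewrite intrD => -> ->. Qed.

Lemma ceil_bounds (t : R) : (Num.ceil t)%:~R - 1 < t <= (Num.ceil t)%:~R.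
Proof. by have := ceil_ge t; have := ceilB1_lt t; rewrite intrB => -> ->. Qed.

Lemma stair_topD1 t : stair_top (t + 1) = stair_top t + 1.
Proof. by rewrite /stair_top floorD1 intrD. Qed.

Lemma stair_botD1 t : stair_bot (t + 1) = stair_bot t + 1.
Proof. by rewrite /stair_bot ceilD1 intrD. Qed.

Lemma staircaseD1 v t : staircase v (t + 1) = staircase v t + 1.
Proof.
rewrite /staircase /= floorD1 intrD.
have -> : t + 1 - ((Num.floor t)%:~R + 1%:~R) = t - (Num.floor t)%:~R by ring.
ring.
Qed.

Lemma stair_top_bound t : 0 <= stair_top t - t <= 1.
Proof. by have := floor_bounds t; rewrite /stair_top; lra. Qed.

Lemma stair_bot_bound t : 0 <= stair_bot t - t <= 1.
Proof. by have := ceil_bounds t; rewrite /stair_bot; lra. Qed.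

(** The nonlinear term of [staircase] lies between the fractional part and 1; all the bounds on
    [staircase] below reduce to this. *)
Lemma staircase_core v (t : R) :
  t - (Num.floor t)%:~R <= Num.min 1 ((t - (Num.floor t)%:~R) / stair_width v) <= 1.
Proof.
have := floor_bounds t; set u := t - _ => tb.
have u01 : 0 <= u < 1 by rewrite /u; lra.
have w0 := stair_width_gt0 v; have w1 := stair_width_le v.
rewrite ge_min lexx /= le_min andbT; apply/andP; split; first by lra.
by rewrite ler_pdivlMr//; nra.
Qed.

Lemma staircase_bound v t : 0 <= staircase v t - t <= 1.
Proof.
have := staircase_core v t; have := floor_bounds t; rewrite /staircase /=.
set m := Num.min _ _; set k : R := (Num.floor t)%:~R.
have w0 := stair_width_gt0 v; have w1 := stair_width_le v; nra.
Qed.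

Lemma staircase_top v t : staircase v t <= stair_top t.
Proof.
have := staircase_core v t; have := floor_bounds t; rewrite /staircase /stair_top /=.
set m := Num.min _ _; set k : R := (Num.floor t)%:~R.
have w0 := stair_width_gt0 v; have w1 := stair_width_le v; nra.
Qed.

Lemma stair_bot_le t t' : t <= t' -> stair_bot t <= stair_bot t'.
Proof. by move=> /le_ceil tt'; rewrite ler_int. Qed.

Lemma stair_top_bot t t' : t < t' -> stair_top t <= stair_bot t'.
Proof.
move=> tt'; rewrite /stair_top /stair_bot.
have -> : (Num.floor t)%:~R + 1 = (Num.floor t + 1)%:~R :> R by rewrite intrD.
rewrite ler_int lezD1 -(ltr_int R).
have := floor_bounds t; have := ceil_bounds t'; lra.
Qed.

(** Strictness comes from the linear summand of slope [stair_width v]; the other summand is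
    nondecreasing. *)
Lemma staircase_lt v t t' : t < t' -> staircase v t < staircase v t'.
Proof.
move=> tt'; rewrite /staircase /=.
have := staircase_core v t; have := staircase_core v t'; rewrite /=.
have w0 := stair_width_gt0 v; have w1 := stair_width_le v.
have [e|ne] := eqVneq (Num.floor t) (Num.floor t').
  rewrite e; set k : R := (Num.floor t')%:~R => _ _.
  have : Num.min 1 ((t - k) / stair_width v) <= Num.min 1 ((t' - k) / stair_width v).
    by rewrite le_min !ge_min lexx /= ler_pM2r ?invr_gt0// lerB ?(ltW tt')// orbT.
  by nra.
have : (Num.floor t + 1 <= Num.floor t')%R.
  by rewrite lezD1 lt_neqAle ne le_floor// ltW.
rewrite -(ler_int R) intrD.
set m := Num.min _ _; set m' := Num.min _ _.
set k : R := (Num.floor t)%:~R; set k' : R := (Num.floor t')%:~R.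
have := floor_bounds t'; rewrite -/k'; nra.
Qed.

(** One expression valid on both sides of the integer [k], from which continuity at [k] can be read
    off. To the left of [k] it starts where the steep piece after [k - 1] has ended. *)
Lemma staircase_local v (k : int) (t : R) :
  k%:~R - 1 + stair_width v < t < k%:~R + 1 ->
  staircase v t = stair_width v * t + (1 - stair_width v) *
    (k%:~R + Num.min 1 (Num.max 0 ((t - k%:~R) / stair_width v))).
Proof.
move=> /andP[t1 t2]; have w0 := stair_width_gt0 v; rewrite /staircase /=; congr (_ + _ * _).
have [tk|tk] := leP k%:~R t.
  have -> : Num.floor t = k by apply: floor_def; rewrite tk intrD.
  by rewrite (@max_r _ _ 0)// divr_ge0 ?subr_ge0// ltW.
have -> : Num.floor t = k - 1.
  by apply: floor_def; rewrite subrK tk intrB andbT; lra.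
rewrite intrB (@max_l _ _ 0); last by rewrite pmulr_lle0 ?invr_gt0//; lra.
rewrite (@min_r _ _ 1 0) ?ler01// min_l; last by rewrite ler_pdivlMr//; lra.
by rewrite addr0 addrNK.
Qed.

Lemma continuous_staircase v : continuous (staircase v).
Proof.
move=> t; have w0 := stair_width_gt0 v; have w1 := stair_width_le v.
pose k := Num.floor t.
pose F t : R := stair_width v * t + (1 - stair_width v) *
    (k%:~R + Num.min 1 (Num.max 0 ((t - k%:~R) / stair_width v))).
have tk : t \in `](k%:~R - 1 + stair_width v), (k%:~R + 1)[.
  by have := floor_bounds t; rewrite in_itv/= -/k; lra.
have FE : \forall s \near t, F s = staircase v s.
  by apply: filterS (near_in_itvoo tk) => s; rewrite in_itv/= => /staircase_local.
have cF : continuous F.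
  have idc := @continuous_idfun R; have cstc := @continuous_cst R R.
  apply: continuousD_fun; first exact: continuousM_fun.
  apply: continuousM_fun => //; apply: continuousD_fun => //.
  apply: continuous_min_fun => //; apply: continuous_max_fun => //.
  by apply: continuousM_fun => //; exact: continuousB_fun.
rewrite /continuous_at -(nbhs_singleton FE).
by apply: cvg_trans (cF t); exact: near_eq_cvg.
Qed.

Lemma stair_top_usc (t0 : R) : \forall t \near t0, stair_top t <= stair_top t0.
Proof.
have : t0 \in `](t0 - 1), (stair_top t0)[.
  by have := floor_bounds t0; rewrite in_itv/= /stair_top; lra.
move/near_in_itvoo; apply: filterS => t; rewrite in_itv/= => /andP[_ tt].
rewrite lerD2r ler_int -ltzD1 -(ltr_int R) intrD; move: tt; rewrite /stair_top.
by have := floor_bounds t; lra.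
Qed.

Lemma stair_bot_lsc (t0 : R) : \forall t \near t0, stair_bot t0 <= stair_bot t.
Proof.
have : t0 \in `](stair_bot t0 - 1), (t0 + 1)[.
  by have := ceil_bounds t0; rewrite in_itv/= /stair_bot; lra.
move/near_in_itvoo; apply: filterS => t; rewrite in_itv/= => /andP[tt _].
rewrite ler_int -ltzD1 -(ltr_int R) intrD; move: tt; rewrite /stair_bot.
by have := ceil_bounds t; lra.
Qed.

(** If the width is smaller than half the distance [u] from [t0] to the jump strictly before it,
    then near [t0] the steep piece after that jump is over and the value is within one width of
    [stair_bot t0], or larger. *)
Lemma staircase_bot (t0 e : R) : 0 < e -> exists n, \forall t \near t0,
  forall v, (n <= v)%N -> stair_bot t0 - e <= staircase v t.
Proof.
move=> e0; pose u := t0 - (stair_bot t0 - 1).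
have cb := ceil_bounds t0.
have u0 : 0 < u by rewrite /u /stair_bot; lra.
have m0 : 0 < Num.min (u / 2) e by rewrite lt_min e0 andbT; lra.
have [n _ nP] := near_infty_natSinv_lt (PosNum m0).
exists n; have : t0 \in `](t0 - u / 2), (t0 + 1)[ by rewrite in_itv/=; lra.
move/near_in_itvoo; apply: filterS => t; rewrite in_itv/= => /andP[t1 t2] v nv.
have := nP v.+1; rewrite /= leqW// => /(_ isT); rewrite lt_min => /andP[wu we].
have w0 := stair_width_gt0 v; have w1 := stair_width_le v.
rewrite -/(stair_width v) in wu we.
have [kt|tk] := leP (stair_bot t0) t; first by have := staircase_bound v t; lra.
have fk : Num.floor t = Num.ceil t0 - 1.
  by apply: floor_def; rewrite subrK intrB tk andbT; move: t1; rewrite /u /stair_bot; lra.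
rewrite /staircase /= fk intrB min_l; last first.
  by rewrite ler_pdivlMr// mul1r; move: t1 wu; rewrite /u /stair_bot; lra.
move: t1 tk; rewrite /u /stair_bot addrNK; nra.
Qed.
End staircase.

Section dyadic_limits.
Context {R : realType}.

Lemma exp2_small (C e : R) : 0 < e -> exists N : nat, C / 2 ^+ N < e.
Proof.
move=> e0; exists (Num.truncn (C / e)).+1.
rewrite ltr_pdivrMr ?exprn_gt0// -ltr_pdivrMl// mulrC.
have := truncnS_gt (C / e); set N := (Num.truncn _).+1 => CN.
apply: (lt_trans CN); rewrite -natrX ltr_nat; exact: ltn_expl.
Qed.

Lemma le_dyadic (x y C : R) : (forall N : nat, x <= y + C / 2 ^+ N) -> x <= y.
Proof.
move=> xy; apply/ler_addgt0Pr => e e0; have [N Ne] := exp2_small C e0.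
by apply: (le_trans (xy N)); rewrite lerD2l ltW.
Qed.
End dyadic_limits.

(** * Weighted averages along an orbit *)

Section average.
Context {R : realType} {A : topologicalType} (tau : A -> A) (alpha : R).
Hypothesis ctau : continuous tau.
Implicit Types (K : A -> R -> R) (c : A) (t : R).

(** The sum of the terms [(K (tau^n c) (t + n alpha) - n alpha) / 2^(n+1)], with [t] split off so
    that the averaged defects stay in [0, 1] and the series converges. *)
Definition orbit_average K c t : R :=
  t + dyadic_average (fun n =>
    K (iter n tau c) (t + n%:R * alpha) - (t + n%:R * alpha)).

Definition defect01 K := forall c t, 0 <= K c t - t <= 1.

Lemma orbit_average_bound K c t : defect01 K -> 0 <= orbit_average K c t - t <= 1.
Proof.
move=> K01; rewrite /orbit_average addrC addKr.
exact: dyadic_average_bound.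
Qed.

Lemma orbit_averageS K c t : defect01 K -> orbit_average K c t =
  K c t / 2 + (orbit_average K (tau c) (t + alpha) - alpha) / 2.
Proof.
move=> K01; rewrite /orbit_average dyadic_averageS; last by move=> n; exact: K01.
rewrite /= mul0r addr0.
set a := dyadic_average _; set b := dyadic_average _.
have -> : a = b.
  rewrite /a /b; congr (dyadic_average _); apply/funext => n /=.
  have -> : t + n.+1%:R * alpha = t + alpha + n%:R * alpha by rewrite -natr1; ring.
  by rewrite -iterS iterSr.
lra.
Qed.

Lemma orbit_averageD1 K c t : (forall c t, K c (t + 1) = K c t + 1) ->
  orbit_average K c (t + 1) = orbit_average K c t + 1.
Proof.
move=> KD; rewrite /orbit_average addrAC; congr (_ + _ + _).
congr (dyadic_average _); apply/funext => n.
by rewrite addrAC KD; ring.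
Qed.

(** The crude bound with error 1 holds because defects lie in [0, 1]. Each use of [orbit_averageS]
    halves the error, so it can be made arbitrarily small. *)
Lemma orbit_average_le K1 K2 (d : R) : defect01 K1 -> defect01 K2 -> 0 <= d ->
  (forall c t, K1 c t <= K2 c (t + d)) ->
  forall c t, orbit_average K1 c t <= orbit_average K2 c (t + d).
Proof.
move=> K1b K2b d0 K12 c t; apply: (@le_dyadic _ _ _ 1) => N.
elim: N c t => [|N IH] c t.
  rewrite expr0 divr1.
  by have := orbit_average_bound c t K1b; have := orbit_average_bound c (t + d) K2b; lra.
rewrite !(orbit_averageS c) // exprSr invfM mulrA.
have := IH (tau c) (t + alpha); have := K12 c t.
by rewrite (addrAC t alpha d); lra.
Qed.

(* With s = 1 this is upper, and with s = -1 lower semicontinuity. *)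
Definition semicontinuous (s : R) K := forall c t (e : R), 0 < e ->
  \forall p \near (c, t), s * K p.1 p.2 <= s * K c t + e.

(** The recursion is unfolded [N] times: the tail contributes at most [3 / 2 ^+ N], and each
    unfolded term is semicontinuous by hypothesis. *)
Lemma orbit_average_semicontinuous K s : `|s| <= 1 -> defect01 K ->
  semicontinuous s K -> semicontinuous s (orbit_average K).
Proof.
move=> s1 Kb Ks.
suff key (N : nat) (e' : R) c t : 0 < e' ->
    \forall p \near (c, t), s * orbit_average K p.1 p.2 <=
      s * orbit_average K c t + (e' + 3 / 2 ^+ N).
  move=> c t e e0; have e20 : 0 < e / 2 by lra.
  have [N Ne] := exp2_small 3 e20.
  apply: filterS (key N _ c t e20) => p /le_trans; apply.
  by rewrite lerD2l; lra.
move=> e'0; elim: N c t => [|N IH] c t.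
  (* For arguments less than 1 apart the averages differ by less than 2, since each exceeds its
     argument by at most 1; 3 is a generous bound. *)
  have : \forall p \near (c, t), `|t - p.2| < 1.
    by have : snd p @[p --> (c, t)] --> t by [exact: cvg_snd]; move/cvgrPdist_lt/(_ _ ltr01).
  apply: filterS => -[c' t'] /= tt'; rewrite expr0 divr1.
  have := orbit_average_bound c t Kb; have := orbit_average_bound c' t' Kb.
  set x := orbit_average _ _ t'; set y := orbit_average _ _ t => b1 b2.
  have xy : `|x - y| <= 3 by move: tt'; rewrite ltr_norml ler_norml; lra.
  have := ler_pM (normr_ge0 s) (normr_ge0 (x - y)) s1 xy.
  rewrite -normrM mul1r => h; rewrite -lerBlDl -mulrBr.
  by apply: (le_trans (ler_norm _)); lra.
have cs : continuous (fun p : A * R => (tau p.1, p.2 + alpha)).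
  apply: continuous_pair.
    by apply: continuous_compose ctau => p; exact: cvg_fst.
  apply: continuousD_fun; last exact: continuous_cst.
  by move=> p; exact: cvg_snd.
have H1 := Ks c t _ e'0.
have H2 := cs (c, t) _ (IH (tau c) (t + alpha)).
near=> p; rewrite (orbit_averageS p.1) // (orbit_averageS c) //.
have h1 : s * K p.1 p.2 <= s * K c t + e' by near: p.
have h2 : s * orbit_average K (tau p.1) (p.2 + alpha) <=
   s * orbit_average K (tau c) (t + alpha) + (e' + 3 / 2 ^+ N) by near: p.
rewrite exprSr invfM mulrA; lra.
Unshelve. all: by end_near. Qed.
End average.

(** * Blowing up the backward orbit of a point *)

Section blowup.
Context {R : realType} {A : topologicalType} (tau : A -> A) (o : A) (v : A -> nat).
Variable alpha : R.
Hypothesis ctau : continuous tau.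
Hypothesis oN : forall n, iter n.+1 tau o <> o.
Hypothesis v_loc : forall c, c <> o -> \forall c' \near c, c' <> o /\ v c' = v c.
Hypothesis v_inf : forall n, \forall c \near o, c <> o -> (n <= v c)%N.
Implicit Types (c : A) (t x : R).

(** The two edges of the multivalued map [K_c]: they coincide with a homeomorphism for [c <> o], and
    at [o] they bound the vertical segments of the limit staircase. *)
Definition upper_step c t : R :=
  if pselect (c = o) then stair_top t else staircase (v c) t.
Definition lower_step c t : R :=
  if pselect (c = o) then stair_bot t else staircase (v c) t.
Let upper := orbit_average tau alpha upper_step.
Let lower := orbit_average tau alpha lower_step.

Lemma upper_step01 : defect01 upper_step.
Proof.
move=> c t; rewrite /upper_step.
by case: pselect => ? /=; [exact: stair_top_bound|exact: staircase_bound].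
Qed.

Lemma lower_step01 : defect01 lower_step.
Proof.
move=> c t; rewrite /lower_step.
by case: pselect => ? /=; [exact: stair_bot_bound|exact: staircase_bound].
Qed.
Let u01 := upper_step01.
Let l01 := lower_step01.

Lemma upper_stepD1 c t : upper_step c (t + 1) = upper_step c t + 1.
Proof.
by rewrite /upper_step; case: pselect => ? /=; rewrite ?stair_topD1 ?staircaseD1.
Qed.

Lemma lower_stepD1 c t : lower_step c (t + 1) = lower_step c t + 1.
Proof.
by rewrite /lower_step; case: pselect => ? /=; rewrite ?stair_botD1 ?staircaseD1.
Qed.

Lemma lower_upper_step c t t' : t <= t' -> lower_step c t <= upper_step c t'.
Proof.
move=> tt'; rewrite /lower_step /upper_step; case: pselect => ? /=.
  apply: (le_trans (stair_bot_le tt')); rewrite /stair_bot /stair_top.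
  rewrite -[_ + 1](intrD _ (Num.floor t') 1) ler_int -ltzD1 -(ltr_int R) intrD.
  have := floor_bounds t'; have := ceil_bounds t'.
  by rewrite !intrD; lra.
move: tt'; rewrite le_eqVlt => /predU1P[->//|/(staircase_lt (v c)) /ltW//].
Qed.

Lemma upper_lower_step c t t' : t < t' -> upper_step c t <= lower_step c t'.
Proof.
move=> tt'; rewrite /lower_step /upper_step; case: pselect => ? /=.
  exact: stair_top_bot.
exact/ltW/staircase_lt.
Qed.

Lemma upper_lower_step_lt c t t' : c <> o -> t < t' -> upper_step c t < lower_step c t'.
Proof.
by move=> co tt'; rewrite /lower_step /upper_step; case: pselect => //= _; exact: staircase_lt.
Qed.

Lemma near_staircase c t (e : R) : c <> o -> 0 < e ->
  \forall p \near (c, t), [/\ p.1 <> o, v p.1 = v c &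
     `|staircase (v c) t - staircase (v c) p.2| < e].
Proof.
move=> co e0.
have H1 : \forall p \near (c, t), p.1 <> o /\ v p.1 = v c.
  exact: (near_fst t (v_loc co)).
have H2 : \forall p \near (c, t), `|staircase (v c) t - staircase (v c) p.2| < e.
  have : staircase (v c) p.2 @[p --> (c, t)] --> staircase (v c) t.
    apply: (@cvg_comp _ _ _ (@snd A R) (staircase (v c))); last exact: continuous_staircase.
    exact: cvg_snd.
  by move/cvgrPdist_lt; exact.
by near=> p; split; [have [] : p.1 <> o /\ v p.1 = v c by near: p
  |have [] : p.1 <> o /\ v p.1 = v c by near: p|near: p].
Unshelve. all: by end_near. Qed.

Lemma upper_step_usc : semicontinuous 1 upper_step.
Proof.
move=> c t e e0; have [co|co] := pselect (c = o).
  have : \forall p \near (c, t), stair_top p.2 <= stair_top t.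
    exact: (near_snd c (stair_top_usc t)).
  apply: filterS => -[c' t'] /= tt'; rewrite !mul1r {2}/upper_step.
  case: pselect => //= _.
  suff : upper_step c' t' <= stair_top t' by lra.
  by rewrite /upper_step; case: pselect => //= _; exact: staircase_top.
apply: filterS (near_staircase t co e0) => -[c' t'] /= [co' vv'].
rewrite /upper_step !mul1r; do 2 (case: pselect => //= _).
by rewrite vv' ltr_norml; lra.
Qed.

(** Unlike the upper edge, which dominates every staircase, the lower edge at [o] is only approached
    as the index grows; this is where [v_inf] enters. *)
Lemma lower_step_lsc : semicontinuous (-1) lower_step.
Proof.
move=> c t e e0; have [co|co] := pselect (c = o).
  have [n nP] := staircase_bot t e0.
  have H1 : \forall p \near (c, t), forall v, (n <= v)%N ->
      stair_bot t - e <= staircase v p.2.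
    exact: (near_snd c nP).
  have H2 : \forall p \near (c, t), p.1 <> o -> (n <= v p.1)%N.
    by rewrite co; exact: (near_fst t (v_inf n)).
  have H3 : \forall p \near (c, t), stair_bot t <= stair_bot p.2.
    exact: (near_snd c (stair_bot_lsc t)).
  near=> p; rewrite !mulN1r.
  have h1 : forall v, (n <= v)%N -> stair_bot t - e <= staircase v p.2 by near: p.
  have h2 : p.1 <> o -> (n <= v p.1)%N by near: p.
  have h3 : stair_bot t <= stair_bot p.2 by near: p.
  rewrite {2}/lower_step; case: pselect => //= _.
  rewrite /lower_step; case: pselect => [?|po] /=; first by lra.
  by have := h1 _ (h2 po); lra.
apply: filterS (near_staircase t co e0) => -[c' t'] /= [co' vv'].
rewrite /lower_step !mulN1r; do 2 (case: pselect => //= _).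
by rewrite vv' ltr_norml; lra.
Unshelve. all: by end_near. Qed.

Lemma upper_usc c t (e : R) : 0 < e ->
  \forall p \near (c, t), upper p.1 p.2 <= upper c t + e.
Proof.
move=> e0; have s1 : `|1| <= 1 :> R by rewrite normr1.
have := orbit_average_semicontinuous alpha ctau s1 u01 upper_step_usc c t e0.
by apply: filterS => p; rewrite !mul1r.
Qed.

Lemma lower_lsc c t (e : R) : 0 < e ->
  \forall p \near (c, t), lower c t - e <= lower p.1 p.2.
Proof.
move=> e0; have s1 : `|-1| <= 1 :> R by rewrite normrN1.
have := orbit_average_semicontinuous alpha ctau s1 l01 lower_step_lsc c t e0.
by apply: filterS => p; rewrite !mulN1r -/lower; lra.
Qed.

Lemma lower_upper c t t' : t <= t' -> lower c t <= upper c t'.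
Proof.
move=> tt'; have <- : t + (t' - t) = t' by rewrite addrC subrK.
apply: orbit_average_le => //; first by rewrite subr_ge0.
by move=> {}c s; apply: lower_upper_step; lra.
Qed.

Lemma upper_lower_le c t t' : t < t' -> upper c t <= lower c t'.
Proof.
move=> tt'; have <- : t + (t' - t) = t' by rewrite addrC subrK.
apply: orbit_average_le => //; first by rewrite subr_ge0 ltW.
by move=> {}c s; apply: upper_lower_step; lra.
Qed.

(** Off [o] the first summand of the recursion is strict. At [o] the strictness is taken from the
    second summand, as [tau o] differs from [o]. *)
Lemma upper_lower c t t' : t < t' -> upper c t < lower c t'.
Proof.
have step c' s s' : c' <> o -> s < s' -> upper c' s < lower c' s'.
  move=> co ss'; rewrite /upper /lower !(orbit_averageS _ _ c')//.
  have := upper_lower_step_lt co ss'.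
  have : upper (tau c') (s + alpha) <= lower (tau c') (s' + alpha).
    by apply: upper_lower_le; rewrite ltrD2r.
  by rewrite /upper /lower; lra.
move=> tt'; have [co|] := pselect (c = o); last by move=> co; exact: step.
rewrite /upper /lower !(orbit_averageS _ _ c)//.
have := upper_lower_step c tt'.
have : upper (tau c) (t + alpha) < lower (tau c) (t' + alpha).
  by apply: step; [rewrite co; move: (@oN 0%N)|rewrite ltrD2r].
by rewrite /upper /lower; lra.
Qed.

Lemma upper_le c t t' : t <= t' -> upper c t <= upper c t'.
Proof.
rewrite le_eqVlt => /predU1P[->//|tt']; apply: (le_trans (upper_lower_le c tt')).
exact: lower_upper.
Qed.

Definition regular c := forall n, iter n tau c <> o.

Lemma upper_eq_lower c t : regular c -> upper c t = lower c t.
Proof.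
move=> rc; rewrite /upper /lower /orbit_average; congr (_ + dyadic_average _).
apply/funext => n; congr (_ - _); rewrite /upper_step /lower_step.
by case: pselect => //= /rc.
Qed.

Lemma regular_tau_o : regular (tau o).
Proof. by move=> n; rewrite -iterSr; exact: oN. Qed.

(** Take the supremum of the [t] with [lower c t <= x]. Lower semicontinuity passes the inequality
    to the supremum; if the upper average there were below [x], upper semicontinuity would put
    larger points into the set. *)
Lemma phase_exists c x : exists t, lower c t <= x <= upper c t.
Proof.
pose S := [set t | lower c t <= x].
have lb t : t <= lower c t by have := orbit_average_bound tau alpha c t l01; rewrite -/lower; lra.
have lb1 t : lower c t <= t + 1 by have := orbit_average_bound tau alpha c t l01; rewrite -/lower; lra.
have S0 : S !=set0 by exists (x - 1); rewrite /S /=; have := lb1 (x - 1); lra.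
have Sub : has_ubound S by exists x => t; rewrite /S /=; apply: le_trans.
have supS : has_sup S by [].
exists (sup S); apply/andP; split; rewrite leNgt; apply/negP => H.
  have e0 : 0 < (lower c (sup S) - x) / 2 by lra.
  have [[U V] /= [nU /nbhs_ballP[d /= d0 dV]] UV] := lower_lsc c (sup S) e0.
  have [t St td] := sup_adherent d0 supS.
  have ts : t <= sup S by apply: sup_upper_bound.
  have : lower c (sup S) - (lower c (sup S) - x) / 2 <= lower c t.
    apply: (UV (c, t)); split => /=; first exact: nbhs_singleton.
    by apply: dV; rewrite /ball /= ger0_norm; lra.
  by move: St; rewrite /S /=; lra.
have e0 : 0 < (x - upper c (sup S)) / 2 by lra.
have [[U V] /= [nU /nbhs_ballP[d /= d0 dV]] UV] := upper_usc c (sup S) e0.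
have dd : ball (sup S) d (sup S + d / 2) by rewrite /ball /= ltr_norml; lra.
have h : upper c (sup S + d / 2) <= upper c (sup S) + (x - upper c (sup S)) / 2.
  by apply: (UV (c, _)); split; [exact: nbhs_singleton|exact: dV].
have Sd : S (sup S + d / 2).
  by rewrite /S /=; have := lower_upper c (lexx (sup S + d / 2)); lra.
have : sup S + d / 2 <= sup S by apply: sup_upper_bound.
lra.
Qed.

(* Generalized inverse of the discontinuous averages. *)
Definition phase c x : R := projT1 (cid (phase_exists c x)).

Lemma phase_bounds c x : lower c (phase c x) <= x <= upper c (phase c x).
Proof. by rewrite /phase; case: cid. Qed.

(** By [upper_lower] the intervals between the two averages at distinct [t] are disjoint. *)
Lemma phaseE c x t : lower c t <= x <= upper c t -> phase c x = t.
Proof.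
move=> tx; have := phase_bounds c x; move: (phase c x) => t' t'x.
apply/eqP; rewrite eq_le !leNgt; apply/andP; split; apply/negP => /(upper_lower c); lra.
Qed.

Lemma phase_gt c x t : upper c t < x -> t < phase c x.
Proof.
move=> tx; rewrite ltNge; apply/negP => /(upper_le c).
by have := phase_bounds c x; lra.
Qed.

Lemma phase_lt c x t : x < lower c t -> phase c x < t.
Proof.
move=> tx; rewrite ltNge le_eqVlt; apply/negP => /predU1P[e|/(upper_lower c)].
  by have := phase_bounds c x; rewrite -e; lra.
by have := phase_bounds c x; have := lower_upper c (lexx t); lra.
Qed.

Lemma phase_le c x x' : x <= x' -> phase c x <= phase c x'.
Proof.
move=> xx'; rewrite leNgt; apply/negP => /(upper_lower c).
by have := phase_bounds c x; have := phase_bounds c x'; lra.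
Qed.

Lemma phase_regular_lt c x x' : regular c -> x < x' -> phase c x < phase c x'.
Proof.
move=> rc xx'; rewrite lt_neqAle phase_le ?(ltW xx')// andbT.
apply/eqP => e; have := phase_bounds c x; have := phase_bounds c x'.
by rewrite e !upper_eq_lower//; lra.
Qed.

Lemma phaseD1 c x : phase c (x + 1) = phase c x + 1.
Proof.
apply: phaseE; rewrite /lower /upper !orbit_averageD1.
- by rewrite !lerD2r; exact: phase_bounds.
- by move=> *; exact: upper_stepD1.
- by move=> *; exact: lower_stepD1.
Qed.

(** At [t = phase c x] the point [x] lies strictly between [upper c (t - e)] and [lower c (t + e)].
    Semicontinuity preserves both strict inequalities nearby, which confines the phase to within [e]
    of [t]. *)
Lemma continuous_phase : continuous (fun p : A * R => phase p.1 p.2).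
Proof.
move=> -[c x]; apply/cvgrPdist_lt => /= e e0; set t := phase c x.
have bt := phase_bounds c x; rewrite -/t in bt.
have g1 : 0 < (x - upper c (t - e)) / 2.
  by have te : t - e < t by [lra]; have := upper_lower c te; lra.
have g2 : 0 < (lower c (t + e) - x) / 2.
  by have te : t < t + e by [lra]; have := upper_lower c te; lra.
have [[U1 V1] /= [nU1 nV1] UV1] := upper_usc c (t - e) g1.
have [[U2 V2] /= [nU2 nV2] UV2] := lower_lsc c (t + e) g2.
have au (r s : R) : r + (s - r) / 2 = (s + r) / 2 by lra.
have al (r s : R) : r - (r - s) / 2 = (s + r) / 2 by lra.
have xI : x \in `]((x + upper c (t - e)) / 2), ((x + lower c (t + e)) / 2)[.
  by rewrite in_itv/=; lra.
exists (U1 `&` U2, `]((x + upper c (t - e)) / 2), ((x + lower c (t + e)) / 2)[%classic).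
  by split => /=; [exact: filterI|exact: near_in_itvoo].
move=> -[c' x'] /= [[U1c U2c]]; rewrite in_itv/= => /andP[x1 x2].
have := UV1 (c', t - e) (conj U1c (nbhs_singleton nV1)) => /= h1.
have := UV2 (c', t + e) (conj U2c (nbhs_singleton nV2)) => /= h2.
rewrite au in h1; rewrite al in h2.
rewrite ltr_distlC (phase_gt (le_lt_trans h1 x1)).
exact: phase_lt (lt_le_trans x2 h2).
Qed.

(* The second line comes from the recursion [orbit_averageS]: if [x] lies between the lower
   and upper averages at [t = phase c x], then this value lies between those at [t + alpha]
   over [tau c]. *)
Definition shift_lift c x : R :=
  if pselect (c = o) then upper (tau o) (phase o x + alpha)
  else 2 * x + alpha - staircase (v c) (phase c x).

Lemma phase_shift c x : phase (tau c) (shift_lift c x) = phase c x + alpha.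
Proof.
rewrite /shift_lift; case: pselect => /= [->|co].
  by apply: phaseE; rewrite upper_eq_lower ?lexx//; exact: regular_tau_o.
have := phase_bounds c x; set t := phase c x; rewrite /lower /upper !(orbit_averageS _ _ c)//.
rewrite /lower_step /upper_step; case: pselect => //= _; rewrite -/upper -/lower => tx.
by apply: phaseE; lra.
Qed.

Lemma shift_liftD1 c x : shift_lift c (x + 1) = shift_lift c x + 1.
Proof.
rewrite /shift_lift; case: pselect => /= [_|_].
  rewrite phaseD1 addrAC /upper orbit_averageD1//.
  by move=> *; exact: upper_stepD1.
by rewrite phaseD1 staircaseD1; ring.
Qed.

(** The interval collapsed to phase 0 over [o] has length exactly 1/2: the jump of the staircase at
    0 has height 1 and enters with weight 1/2, while the remaining summands agree because [tau o] is
    regular. *)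
Lemma shift_lift_flat : exists a, forall x, a <= x <= a + 1 / 2 ->
  shift_lift o x = shift_lift o a.
Proof.
exists (lower o 0) => x xa; rewrite /shift_lift; case: pselect => //= _.
suff E y : lower o 0 <= y <= lower o 0 + 1 / 2 -> phase o y = 0.
  by rewrite !E// lexx; lra.
suff -> : lower o 0 + 1 / 2 = upper o 0 by exact: phaseE.
rewrite /lower /upper !(orbit_averageS _ _ o)// -/upper -/lower.
rewrite upper_eq_lower; last exact: regular_tau_o.
rewrite /lower_step /upper_step; case: pselect => //= _.
by rewrite /stair_bot /stair_top ceil0 floor0; lra.
Qed.

(** Off [o] the defining formula is continuous since [v] is locally constant. At [o] the value [y]
    is recovered from its phase: over the regular point [tau o] the phases of [y - e] and [y + e]
    strictly enclose that of [y], and by continuity they still enclose the shifted phase nearby. *)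
Lemma continuous_shift_lift : continuous (fun p : A * R => shift_lift p.1 p.2).
Proof.
move=> -[c x]; apply/cvgrPdist_lt => /= e e0; have cp := continuous_phase.
have [co|co] := pselect (c = o); last first.
  pose F (p : A * R) := 2 * p.2 + alpha - staircase (v c) (phase p.1 p.2).
  have cF : continuous F.
    apply: continuousB_fun.
      apply: continuousD_fun; last exact: continuous_cst.
      apply: continuousM_fun; first exact: continuous_cst.
      by move=> p; exact: cvg_snd.
    by apply: continuous_compose cp _; exact: continuous_staircase.
  have := cF (c, x); move/cvgrPdist_lt/(_ _ e0) => H1.
  have H2 := near_fst x (v_loc co).
  near=> p; rewrite {1}/shift_lift; case: pselect => //= _.
  have [po vp] : p.1 <> o /\ v p.1 = v c by near: p.
  rewrite /shift_lift; case: pselect => //= _; rewrite vp.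
  have : `|F (c, x) - F p| < e by near: p.
  by [].
have rt := regular_tau_o.
have := phase_shift c x; move: (shift_lift c x) => y yE.
have g1 : phase (tau c) (y - e) < phase c x + alpha.
  by rewrite -yE co phase_regular_lt// gtrBl.
have g2 : phase c x + alpha < phase (tau c) (y + e).
  by rewrite -yE co phase_regular_lt// ltrDl.
have cG z : continuous (fun p : A * R => phase p.1 p.2 + alpha - phase (tau p.1) z).
  apply: continuousB_fun.
    by apply: continuousD_fun => //; exact: continuous_cst.
  apply: (@continuous_compose _ _ _ (fun p : A * R => (tau p.1, z)) _ _ cp).
  apply: continuous_pair; last exact: continuous_cst.
  by apply: continuous_compose ctau => p; exact: cvg_fst.
have g1' : 0 < phase c x + alpha - phase (tau c) (y - e) by rewrite subr_gt0.
have g2' : phase c x + alpha - phase (tau c) (y + e) < 0 by rewrite subr_lt0.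
have H1 := cvgr_gt _ (cG (y - e) (c, x)) _ g1'.
have H2 := cvgr_lt _ (cG (y + e) (c, x)) _ g2'.
near=> p; rewrite ltr_norml.
have h1 : 0 < phase p.1 p.2 + alpha - phase (tau p.1) (y - e) by near: p; exact: H1.
have h2 : phase p.1 p.2 + alpha - phase (tau p.1) (y + e) < 0 by near: p; exact: H2.
rewrite -phase_shift subr_gt0 in h1; rewrite -phase_shift subr_lt0 in h2.
have y1 : y - e < shift_lift p.1 p.2.
  by rewrite ltNge; apply/negP => /(phase_le (tau p.1)); rewrite leNgt h1.
have y2 : shift_lift p.1 p.2 < y + e.
  by rewrite ltNge; apply/negP => /(phase_le (tau p.1)); rewrite leNgt h2.
by rewrite ltrNl opprB ltrBlDl y2 ltrBlDl -ltrBlDr.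
Unshelve. all: by end_near. Qed.
End blowup.

(** * Irrational rotations *)

Section irrational_rotation.
Context {R : realType}.

Definition irrational (a : R) := forall (m n : int), m != 0 -> a * m%:~R <> n%:~R.

(** In [2 * p ^ 2 = q ^ 2] the exponents of 2 on the two sides have different parity. *)
Lemma irrational_sqrt2 : irrational (Num.sqrt 2).
Proof.
move=> m n m0 /(congr1 (fun x => x ^+ 2)).
rewrite exprMn sqr_sqrtr ?ler0n// => h.
have {h} : 2 * m ^+ 2 = n ^+ 2.
  by apply: (@intr_inj R); rewrite intrM !rmorphXn.
move/(congr1 absz); rewrite abszM !abszX /=.
have am : (0 < `|m|)%N by rewrite absz_gt0.
move: am; move: `|m|%N `|n|%N => p q p0 pq.
have q0 : (0 < q)%N.
  by rewrite lt0n; apply/eqP => q0; move: pq; rewrite q0; nia.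
have := congr1 (logn 2) pq; rewrite lognM// ?expn_gt0 ?p0// !lognX (logn_prime 2 (_ : prime 2))//=.
lia.
Qed.

Lemma irrationalMn a (m : nat) : (0 < m)%N -> irrational a -> irrational (m%:R * a).
Proof.
move=> m0 ia p q p0 e; apply: (ia (m%:Z * p) q); first by rewrite mulf_neq0//; lia.
by rewrite -e intrM; ring.
Qed.

(** Dirichlet's pigeonhole argument: two of [N + 1] fractional parts share one of [N] boxes of
    length [1 / N], and irrationality keeps their difference nonzero. *)
Lemma small_multiple a (e : R) : irrational a -> 0 < e ->
  exists (m : nat) (k : int), m%:R * a + k%:~R != 0 /\ `|m%:R * a + k%:~R| < e.
Proof.
move=> ia e0.
pose N := (Num.truncn e^-1).+1; have N0 : (0 < N%:R :> R) by rewrite ltr0n.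
have Ne : N%:R^-1 < e.
  by rewrite invf_plt ?posrE//; exact: truncnS_gt.
pose fr (i : nat) : R := i%:R * a - (Num.floor (i%:R * a))%:~R.
have fr01 i : 0 <= fr i < 1.
  by have := floor_le (i%:R * a); have := floorD1_gt (i%:R * a); rewrite /fr intrD; lra.
pose box (i : 'I_N.+1) : 'I_N := inord (Num.truncn (N%:R * fr i)).
have boxE i : box i = Num.truncn (N%:R * fr i) :> nat.
  rewrite /box inordK// -/N.
  have /andP[f0 f1] := fr01 i.
  by rewrite truncn_lt_nat; [nra|apply: mulr_ge0 => //; exact: ltW].
have : ~~ injectiveb box.
  by apply/injectiveP => /leq_card; rewrite !card_ord ltnn.
case/injectivePn => i [j ij] /(congr1 (@nat_of_ord _)); rewrite !boxE => e1.
wlog lt_ij : i j ij e1 / (j < i)%N => [H|].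
  have [|ji|/val_inj ji] := ltngtP j i; first exact: H.
    by apply: (H j i) => //; rewrite eq_sym.
  by rewrite ji eqxx in ij.
exists (i - j)%N, (Num.floor (j%:R * a) - Num.floor (i%:R * a)).
have -> : (i - j)%:R * a + (Num.floor (j%:R * a) - Num.floor (i%:R * a))%:~R = fr i - fr j.
  by rewrite natrB ?(ltnW lt_ij)// intrB /fr; ring.
split.
  apply/eqP => /eqP; rewrite subr_eq0 /fr => /eqP h.
  apply: (ia (i%:Z - j%:Z) (Num.floor (i%:R * a) - Num.floor (j%:R * a))).
    by rewrite subr_eq0; apply/eqP => -[]; lia.
  by rewrite !intrB -!pmulrn; lra.
apply: lt_trans Ne; rewrite -(ltr_pM2l N0) mulfV ?gt_eqF//.
have tb k : (Num.truncn (N%:R * fr k))%:R <= N%:R * fr k < (Num.truncn (N%:R * fr k)).+1%:R.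
  by apply: truncn_itv; have /andP[f0 f1] := fr01 k; apply: mulr_ge0 => //; exact: ltW.
rewrite -[X in X * _](gtr0_norm N0) -normrM mulrBr ltr_norml.
by have := tb i; have := tb j; rewrite e1 -natr1; lra.
Qed.

(** Walk towards [s] in steps [d] shorter than [e]. As only nonnegative multiples are allowed, the
    integer [K] places the start at or below [s] when [d > 0] and at or above it when [d < 0]. *)
Lemma irrational_dense a (t s e : R) : irrational a -> 0 < e ->
  exists (n : nat) (k : int), `|t + n%:R * a + k%:~R - s| < e.
Proof.
move=> ia e0; have [m [k [d0]]] := small_multiple ia e0.
set d := _ + _ in d0 *; move=> de.
have key (q : nat) (K : int) : `|t + q%:R * d + K%:~R - s| < e ->
  exists (n : nat) (k : int), `|t + n%:R * a + k%:~R - s| < e.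
  move=> h; exists (q * m)%N, (q%:Z * k + K); congr (`| _ | < _): h.
  by rewrite /d natrM intrD intrM -pmulrn; ring.
have [dp|dn|d0'] := ltgtP 0 d; last by rewrite -d0' eqxx in d0.
  pose K : int := Num.floor (s - t).
  have Kb := floor_le (s - t).
  apply: (key (Num.truncn ((s - t - K%:~R) / d)) K).
  have := @truncn_itv R ((s - t - K%:~R) / d); rewrite divr_ge0 ?subr_ge0 ?(ltW dp)// => /(_ isT).
  set q := Num.truncn _; rewrite ler_pdivlMr// ltr_pdivrMr// -natr1 mulrDl mul1r.
  by move: de; rewrite !ltr_norml; lra.
pose K : int := Num.ceil (s - t).
have Kb := ceil_ge (s - t).
apply: (key (Num.truncn ((s - t - K%:~R) / d)) K).
have := @truncn_itv R ((s - t - K%:~R) / d).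
rewrite -mulrNN -invrN divr_ge0 ?oppr_ge0 ?subr_le0 ?(ltW dn)// => /(_ isT).
rewrite invrN mulrNN; set q := Num.truncn _.
rewrite ler_ndivlMr// ltr_ndivrMr// -natr1 mulrDl mul1r.
by move: de; rewrite !ltr_norml; lra.
Qed.
End irrational_rotation.

(** * The dyadic odometer *)

Section set_type_topology.
Context {X : topologicalType} (A : set X).

Lemma continuous_set_val : continuous (set_val : set_type A -> X).
Proof. exact: initial_continuous. Qed.

Lemma continuous_to_set_type (Y : topologicalType) (g : Y -> set_type A) :
  continuous (fun y => set_val (g y)) -> continuous g.
Proof.
by move=> /continuousP cg; apply/continuousP => _ [W oW <-]; exact: cg.
Qed.

Lemma set_type_hausdorff : hausdorff_space X -> hausdorff_space (set_type A).
Proof.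
move=> hX x y xy; apply: val_inj; apply: hX.
exact: cluster_continuous continuous_set_val xy.
Qed.

Definition to_set_type (a : set_type A) (x : X) : set_type A := insubd a x.

Lemma to_set_typeK a x : A x -> set_val (to_set_type a x) = x.
Proof. by move=> Ax; rewrite set_valE insubdK ?inE. Qed.

Lemma set_valK a : cancel set_val (to_set_type a).
Proof. by move=> x; rewrite set_valE; exact: valKd. Qed.

Lemma within_continuous_to_set_type a : {within A, continuous (to_set_type a)}.
Proof.
apply/continuousP => _ [W oW <-]; apply/open_subspaceP; exists W => //.
apply/seteqP; split=> x [Wx Ax]; split=> //; move: Wx;
  by rewrite /from_subspace /= to_set_typeK.
Qed.

Lemma set_type_image (a : set_type A) : [set: set_type A] = to_set_type a @` A.
Proof.
apply/seteqP; split=> // x _; exists (set_val x); first exact: set_valP.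
exact: set_valK.
Qed.

Lemma set_type_compact : compact A -> compact [set: set_type A].
Proof.
have [[a Aa]|A0 _] := pselect (A !=set0).
  have a' : set_type A by exists a; rewrite inE.
  by move=> cA; rewrite (set_type_image a'); apply: continuous_compact => //;
    exact: within_continuous_to_set_type.
suff -> : [set: set_type A] = set0 by exact: compact0.
by apply/seteqP; split=> // x _; apply: A0; exists (set_val x); exact: set_valP.
Qed.

Lemma set_type_connected : connected A -> connected [set: set_type A].
Proof.
have [[a Aa]|A0 _] := pselect (A !=set0).
  have a' : set_type A by exists a; rewrite inE.
  by move=> cA; rewrite (set_type_image a'); apply: connected_continuous_connected => //;
    exact: within_continuous_to_set_type.
suff -> : [set: set_type A] = set0 by exact: connected0.
by apply/seteqP; split=> // x _; apply: A0; exists (set_val x); exact: set_valP.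
Qed.
End set_type_topology.

(** * Cylinders of the Cantor space *)

Section cylinders.
Implicit Types c : cantor_space.

Definition agree (m : nat) c c' := forall j, (j < m)%N -> c j = c' j.

Lemma near_bit c j : \forall c' \near c, c j = c' j.
Proof.
have H : nbhs (proj j c) [set c j].
  by apply: open_nbhs_nbhs; split=> //; exact: discrete_open.
have H' : nbhs c (proj j @^-1` [set c j]) := @proj_continuous nat (fun=> bool) j c _ H.
by apply: (filterS _ H') => c' /= <-.
Qed.

Lemma near_agree c m : \forall c' \near c, agree m c c'.
Proof.
elim: m => [|m IH]; first by apply: (@filterE _ (nbhs c)) => c' j.
near=> c'; move=> j; rewrite ltnS leq_eqVlt => /predU1P[->|jm].
  by near: c'; exact: near_bit.
have cc' : agree m c c' by near: c'.
exact: cc'.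
Unshelve. all: by end_near. Qed.

(** Every point off the interior of [U] differs from [c] at some digit; compactness of that
    complement bounds the position of the digit uniformly. *)
Lemma nbhs_agree c (U : set cantor_space) :
  nbhs c U -> exists m, forall c', agree m c c' -> U c'.
Proof.
move=> nU; have cK : compact (~` U°).
  apply: (subclosed_compact _ cantor_space_compact) => //.
  exact/open_closedC/open_interior.
have : \forall m \near \oo, ~` U° `<=` (fun x => ~ agree m c x).
  move/compact_near_coveringP : cK; apply => x Ux.
  have [j xj] : exists j, c j <> x j.
    apply/existsNP => H; apply: Ux; have -> : x = c by apply/funext.
    exact: nU.
  exists ([set x' | x j = x' j], [set m | (j < m)%N]).
    by split=> /=; [exact: near_bit|exact: nbhs_infty_gt].
  by move=> [x' m] /= [xj' jm] cx'; apply: xj; rewrite xj' cx'.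
move=> [m _ /(_ m (leqnn m)) H]; exists m => c' cc'.
by apply: interior_subset; apply: contrapT => /H.
Qed.

Lemma continuous_to_cantor (X : topologicalType) (g : X -> cantor_space) :
  (forall j x, \forall y \near x, g x j = g y j) -> continuous g.
Proof.
move=> gj x U /nbhs_agree[m mU].
have : \forall y \near x, agree m (g x) (g y).
  elim: m {mU} => [|m IH]; first by apply: (@filterE _ (nbhs x)) => y j.
  near=> y; move=> j; rewrite ltnS leq_eqVlt => /predU1P[->|jm].
    by near: y; exact: gj.
  have cc' : agree m (g x) (g y) by near: y.
  exact: cc'.
by apply: filterS => y; exact: mU.
Unshelve. all: by end_near. Qed.
End cylinders.

Section odometer.
Implicit Types c : cantor_space.
Local Open Scope nat_scope.

Definition cantor0 : cantor_space := fun=> false.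

Fixpoint carry c n : bool := if n is m.+1 then carry c m && c m else true.

(** Addition of 1 in the 2-adic integers, least significant digit first. Correspondingly
    [low_digits m] is the residue modulo [2 ^ m]. *)
Definition odometer c : cantor_space := fun n => c n (+) carry c n.

Definition low_digits m c : nat := \sum_(j < m) c j * 2 ^ j.

Lemma low_digits_lt m c : low_digits m c < 2 ^ m.
Proof.
rewrite /low_digits; elim: m => [|m IH]; first by rewrite big_ord0.
rewrite big_ord_recr /= expnS; move: IH; set s := \sum_(i < m) _.
by case: (c m); lia.
Qed.

Lemma low_digitsS m c : low_digits m.+1 c = low_digits m c + c m * 2 ^ m.
Proof. by rewrite /low_digits big_ord_recr. Qed.

Lemma low_digits_agree m c c' : agree m c c' <-> low_digits m c = low_digits m c'.
Proof.
split=> [cc'|]; first by apply: eq_bigr => i _; rewrite cc'.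
elim: m => [_ j //|m IH].
rewrite !low_digitsS; have := low_digits_lt m c; have := low_digits_lt m c'.
move=> l1 l2 e; have [em cm] : low_digits m c = low_digits m c' /\ c m = c' m.
  by move: e; case: (c m); case: (c' m); rewrite ?mul1n ?mul0n; lia.
by move=> j; rewrite ltnS leq_eqVlt => /predU1P[->//|]; exact: IH.
Qed.

Lemma low_digits_odometer1 m c :
  low_digits m (odometer c) + carry c m * 2 ^ m = low_digits m c + 1.
Proof.
elim: m => [|m IH]; first by rewrite /low_digits !big_ord0.
rewrite !low_digitsS expnS; move: IH; have -> : odometer c m = c m (+) carry c m by [].
rewrite /=; set a := low_digits _ _; set b := low_digits _ _; set e := 2 ^ m.
by case: (carry c m); case: (c m); rewrite /= ?mul1n ?mul0n; lia.
Qed.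

Lemma low_digits_odometer m c n :
  low_digits m (iter n odometer c) = (low_digits m c + n) %% 2 ^ m.
Proof.
elim: n => [|n IH]; first by rewrite addn0 modn_small// low_digits_lt.
rewrite -(modn_small (low_digits_lt m _)) iterS.
rewrite -(modnMDl (carry (iter n odometer c) m)) addnC low_digits_odometer1.
by rewrite IH modnDml -addnA addn1.
Qed.

Lemma low_digits0 m : low_digits m cantor0 = 0.
Proof. by rewrite /low_digits big1// => i _; rewrite mul0n. Qed.

Lemma eq_agree c c' : (forall m, agree m c c') -> c = c'.
Proof. by move=> cc'; apply/funext => j; exact: (cc' j.+1). Qed.

Lemma odometer_iter_eq0 c n :
  iter n odometer c = cantor0 <-> forall m, 2 ^ m %| low_digits m c + n.
Proof.
split=> [e m|H].
  by have := low_digits_odometer m c n; rewrite e low_digits0 => /esym/eqP.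
apply: eq_agree => m; apply/low_digits_agree.
by rewrite low_digits0 low_digits_odometer; apply/eqP; exact: H.
Qed.

Lemma odometer0_aperiodic n : iter n.+1 odometer cantor0 <> cantor0.
Proof.
move/odometer_iter_eq0/(_ n.+1); rewrite low_digits0 add0n => /dvdn_leq.
by have := ltn_expl n.+1 (isT : 1 < 2); lia.
Qed.

Lemma odometer_inj : injective odometer.
Proof.
move=> c c' e; apply: eq_agree => m; apply/low_digits_agree.
have := low_digits_odometer1 m c; have := low_digits_odometer1 m c'; rewrite e.
have := low_digits_lt m c; have := low_digits_lt m c'.
have := low_digits_lt m (odometer c').
by case: (carry c m); case: (carry c' m); lia.
Qed.

Lemma carry_agree m c c' : agree m c c' -> carry c m = carry c' m.
Proof.
elim: m => //= m IH cc'.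
by rewrite cc'// IH// => i im; apply: cc'; rewrite ltnW.
Qed.

Lemma continuous_odometer : continuous odometer.
Proof.
apply: continuous_to_cantor => j c; near=> c'.
have cc' : agree j.+1 c c' by near: c'; exact: near_agree.
rewrite /odometer cc'//; congr (_ (+) _).
by apply: carry_agree => i ij; apply: cc'; rewrite ltnW.
Unshelve. all: by end_near. Qed.

Lemma continuous_odometer_iter n : continuous (iter n odometer).
Proof.
elim: n => [|n IH]; first exact: continuous_idfun.
exact: continuous_compose IH continuous_odometer.
Qed.

(** The 2-adic valuation; its value 0 at [cantor0] is a mere default. *)
Definition valuation c : nat :=
  if pselect (exists k, c k) is left h then ex_minn h else 0.

Lemma valuationP c k : c k -> (forall j, j < k -> c j = false) -> valuation c = k.
Proof.
move=> ck jk; rewrite /valuation; case: pselect => [h|[]]; last by exists k.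
case: ex_minnP => m cm mk; apply/eqP; rewrite eqn_leq mk// leqNgt.
by apply/negP => /jk; rewrite cm.
Qed.

Lemma valuation_neq0 c : c <> cantor0 ->
  c (valuation c) /\ forall j, j < valuation c -> c j = false.
Proof.
move=> c0; have h : exists k, c k.
  apply: contrapT => h; apply: c0; apply/funext => k.
  by apply/negbTE/negP => ck; apply: h; exists k.
have [m cm mk] := ex_minnP h; rewrite (valuationP cm).
  by split=> // j jm; apply/negbTE/negP => /mk; rewrite leqNgt jm.
by move=> j jm; apply/negbTE/negP => /mk; rewrite leqNgt jm.
Qed.

Lemma valuation_agree c c' m : c <> cantor0 -> valuation c < m -> agree m c c' ->
  c' <> cantor0 /\ valuation c' = valuation c.
Proof.
move=> /valuation_neq0[ck jk] km cc'; split.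
  by move=> e; move: ck; rewrite cc'// e.
apply: valuationP; first by rewrite -cc'.
by move=> j jv; rewrite -cc' ?jk//; exact: ltn_trans km.
Qed.

Lemma valuation_locally_constant c : c <> cantor0 ->
  \forall c' \near c, c' <> cantor0 /\ valuation c' = valuation c.
Proof.
move=> c0; apply: filterS (near_agree c (valuation c).+1) => c'.
exact: valuation_agree.
Qed.

Lemma valuation_infty n : \forall c \near cantor0, c <> cantor0 -> n <= valuation c.
Proof.
apply: filterS (near_agree cantor0 n) => c cc' /valuation_neq0[ck _].
by rewrite leqNgt; apply/negP => /cc'; rewrite ck.
Qed.
End odometer.

(** * The doubled odometer *)

Lemma bit_clopen (X : topologicalType) (g : X -> bool) b :
  (forall x, \forall y \near x, g x = g y) -> clopen [set x | g x = b].
Proof.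
move=> gl; split.
  by rewrite openE => x /= gx; apply: filterS (gl x) => y /= <-.
rewrite -openC openE => x /= gx; apply: filterS (gl x) => y /= gxy gy; apply: gx.
by rewrite gxy.
Qed.

Lemma cantor_like_is_cantor_set (R : realType) (T : pseudoMetricType R) (p : T) :
  cantor_like T -> is_cantor_set T.
Proof.
move=> clT.
(* The characterization of the Cantor space is stated for pointed spaces, so [p] serves as base
   point. *)
pose T' := HB.pack_for (pseudoPMetricType R) T (isPointed.Build T p).
have [f [cf _]] := @homeomorphism_cantor_like R T' clT.
have [g fg] : exists g, homeo [set: cantor_space] (f @` setT) f g.
  apply: compact_inj_homeo => //.
  - exact: (fun _ : nat => true).
  - by case: clT.
  - exact: cantor_space_compact.
  - exact: continuous_subspaceT.
have [c1 [c2 [h1 [h2 [h3 h4]]]]] := fg.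
have fT : f @` [set: cantor_space] = [set: T].
  by apply/seteqP; split=> // x _; have [y _ <-] := @surj _ _ _ _ f x I; exists y.
rewrite fT in c2 h1 h2 h4.
by exists g; exists f; do ! split.
Qed.

(* Over a sequence of digits the marks are forced, except that at the time (if any) at
   which the orbit of the digits passes through [cantor0] the mark is free. Thus the points
   over the backward orbit of [cantor0], including [cantor0] itself, are doubled, and
   [doubled_step] identifies exactly the two points over [cantor0]. *)
Definition doubled_set : set (cantor_space * cantor_space) :=
  [set p | forall n, iter n odometer p.1 = cantor0 \/
     odd (valuation (iter n odometer p.1)) = p.2 n].

Local Notation doubled_odometer := (set_type doubled_set).

Definition digits (z : doubled_odometer) : cantor_space := (set_val z).1.
Definition marks (z : doubled_odometer) : cantor_space := (set_val z).2.

Lemma digits_marks (z : doubled_odometer) n :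
  iter n odometer (digits z) = cantor0 \/
  odd (valuation (iter n odometer (digits z))) = marks z n.
Proof. exact: (set_valP z). Qed.

Lemma doubled_eq (z z' : doubled_odometer) :
  digits z = digits z' -> marks z = marks z' -> z = z'.
Proof.
move=> d m; apply: val_inj.
by rewrite -!set_valE [LHS]surjective_pairing [RHS]surjective_pairing -/(digits z)
  -/(marks z) d m.
Qed.

Lemma doubled_build c (i : cantor_space) :
  (forall n, iter n odometer c = cantor0 \/ odd (valuation (iter n odometer c)) = i n) ->
  exists z, digits z = c /\ marks z = i.
Proof.
move=> ci; have cB : (c, i) \in doubled_set by rewrite inE.
by exists (exist _ (c, i) cB).
Qed.

Lemma continuous_digits : continuous digits.
Proof.
apply: (continuous_compose (f := set_val) (g := fst)); first exact: continuous_set_val.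
by move=> p; exact: cvg_fst.
Qed.

Lemma continuous_marks : continuous marks.
Proof.
apply: (continuous_compose (f := set_val) (g := snd)); first exact: continuous_set_val.
by move=> p; exact: cvg_snd.
Qed.

Lemma near_mark (z : doubled_odometer) n : \forall z' \near z, marks z n = marks z' n.
Proof. exact: (continuous_marks (near_bit (marks z) n)). Qed.

Lemma near_digit (z : doubled_odometer) n : \forall z' \near z, digits z n = digits z' n.
Proof. exact: (continuous_digits (near_bit (digits z) n)). Qed.

Lemma doubled_step_in (z : doubled_odometer) :
  (odometer (digits z), (fun n => marks z n.+1) : cantor_space) \in doubled_set.
Proof. by rewrite inE => n /=; rewrite -iterSr; exact: digits_marks. Qed.

Definition doubled_step (z : doubled_odometer) : doubled_odometer :=
  exist (fun p => p \in doubled_set) _ (doubled_step_in z).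

Lemma digits_step z : digits (doubled_step z) = odometer (digits z).
Proof. by []. Qed.

Lemma marks_step z n : marks (doubled_step z) n = marks z n.+1.
Proof. by []. Qed.

Lemma digits_iter z n : digits (iter n doubled_step z) = iter n odometer (digits z).
Proof. by elim: n => //= n IH; rewrite digits_step IH. Qed.

Lemma continuous_doubled_step : continuous doubled_step.
Proof.
apply: continuous_to_set_type; apply: continuous_pair.
  exact: continuous_compose continuous_digits continuous_odometer.
apply: continuous_to_cantor => j z; exact: near_mark.
Qed.

(** The digits agree as the odometer is injective; unless they are [cantor0], they also force the
    mark at time 0. *)
Lemma doubled_step_collision z z' : doubled_step z = doubled_step z' ->
  marks z 0%N <> marks z' 0%N -> digits z = cantor0.
Proof.
move=> /(congr1 digits); rewrite !digits_step => /odometer_inj d m.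
have := digits_marks z 0; have := digits_marks z' 0; rewrite /= d.
by case=> // e1 [//|e2]; exfalso; apply: m; rewrite -e1 -e2.
Qed.

(** The orbit of [cantor0] never returns, so all marks at positive times are forced. *)
Lemma doubled_step_eq z z' : digits z = digits z' ->
  digits z = cantor0 -> doubled_step z = doubled_step z'.
Proof.
move=> d d0; apply: doubled_eq; first by rewrite !digits_step d.
apply/funext => n; rewrite !marks_step.
have := digits_marks z n.+1; have := digits_marks z' n.+1; rewrite -d d0.
by case=> [/odometer0_aperiodic//|<-]; case=> [/odometer0_aperiodic//|<-].
Qed.

Lemma doubled0_exists (b : bool) : exists z, digits z = cantor0 /\ marks z 0%N = b.
Proof.
have [|z [d m]] := @doubled_build cantor0
  (fun n => if n is 0 then b else odd (valuation (iter n odometer cantor0))).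
  by case=> [|n]; [left|right].
by exists z; rewrite d m.
Qed.

Lemma doubled_over c : exists z, digits z = c.
Proof.
have [|z [d m]] := @doubled_build c (fun n => odd (valuation (iter n odometer c))).
  by move=> n; right.
by exists z.
Qed.

Lemma near_iter_valuation c k : \forall c' \near c, forall n, (n < k)%N ->
  iter n odometer c <> cantor0 -> iter n odometer c' <> cantor0 /\
  valuation (iter n odometer c') = valuation (iter n odometer c).
Proof.
elim: k => [|k IH]; first by apply: (@filterE _ (nbhs c)).
have [ck|ck] := pselect (iter k odometer c = cantor0).
  apply: filterS IH => c' IH n; rewrite ltnS leq_eqVlt => /predU1P[->//|]; exact: IH.
have H := continuous_odometer_iter (valuation_locally_constant ck).
apply: filterS2 IH H => c' IH H n; rewrite ltnS leq_eqVlt => /predU1P[-> _|].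
  exact: H.
exact: IH.
Qed.

Lemma near_prod_agree (p : cantor_space * cantor_space) U : nbhs p U ->
  exists k, forall p', agree k p.1 p'.1 -> agree k p.2 p'.2 -> U p'.
Proof.
move=> [[V W] /= [/nbhs_agree[m mV] /nbhs_agree[n nW]] VW].
exists (maxn m n) => p' h1 h2; apply: VW; split.
  by apply: mV => j jm; apply: h1; rewrite leq_max jm.
by apply: nW => j jm; apply: h2; rewrite leq_max jm orbT.
Qed.

(* The marks in a neighbourhood are prescribed by finitely many digits alone: at the
   single time where the orbit of the digits meets [cantor0], the first differing
   digit can be put at a position of the right parity. *)
Lemma doubled_cylinder (z : doubled_odometer) U : nbhs z U ->
  exists c0 m, forall z', agree m c0 (digits z') -> U z'.
Proof.
move=> [_ [[W oW <-] /= Wz WU]].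
have [k kW] : exists k, forall p', agree k (digits z) p'.1 -> agree k (marks z) p'.2 -> W p'.
  by apply: near_prod_agree; apply: open_nbhs_nbhs.
have [M0 M0P] := nbhs_agree (near_iter_valuation (digits z) k).
pose M := maxn k M0.
(* Before time [k], marks at times when the orbit is off [cantor0] are determined by [M] digits;
   only a passage through [cantor0] needs care. *)
have key z' : agree M (digits z) (digits z') ->
    (forall n, (n < k)%N -> iter n odometer (digits z) = cantor0 -> marks z n = marks z' n) ->
    U z'.
  move=> ag H; apply: WU; apply: kW.
    by move=> j jk; apply: ag; rewrite leq_max jk.
  move=> n nk; rewrite -/(marks z').
  have [c0|c0] := pselect (iter n odometer (digits z) = cantor0).
    exact: H.
  have [|c'0 vv] := M0P (digits z') _ n nk c0.
    by move=> j jk; apply: ag; rewrite leq_max jk orbT.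
  have [//|<-] := digits_marks z n; have [//|<-] := digits_marks z' n.
  by rewrite vv.
have [[n0 n0k n0c]|no] := pselect
    (exists2 n, (n < k)%N & iter n odometer (digits z) = cantor0); last first.
  exists (digits z), M => z' ag; apply: key => // n nk nc.
  by exfalso; apply: no; exists n.
(* The first position from [M] on whose parity is the mark to be prescribed. *)
pose m := if odd M == marks z n0 then M else M.+1.
have mM : (M <= m)%N by rewrite /m; case: ifP.
have om : odd m = marks z n0.
  by rewrite /m; case: eqP => // /eqP; rewrite /=; case: (odd M); case: (marks z n0).
(* Flipping digit [m] makes the orbit miss [cantor0] at time [n0] and have valuation exactly [m]
   there. *)
pose c0 : cantor_space := fun j => if (j == m) then ~~ digits z j else digits z j.
exists c0, m.+1 => z' ag.
have agm : agree m (digits z) (digits z').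
  move=> j jm; have <- : c0 j = digits z' j by apply: ag; rewrite ltnS ltnW.
  by rewrite /c0 ltn_eqF.
have zm : digits z' m = ~~ digits z m by have <- := ag m (ltnSn m); rewrite /c0 eqxx.
apply: key => [j jM|n nk nc]; first by apply: agm; exact: leq_trans mM.
have -> : n = n0.
  (* The orbit passes through [cantor0] at most once. *)
  have H a b : (a < b)%N -> iter a odometer (digits z) = cantor0 ->
      iter b odometer (digits z) <> cantor0.
    move=> ab ea; have -> : b = ((b - a).-1.+1 + a)%N by lia.
    by rewrite iterD ea; exact: odometer0_aperiodic.
  by have [/H/(_ nc)|/H/(_ n0c)|//] := ltngtP n n0.
set d := iter n0 odometer (digits z').
have dlow : agree m d cantor0.
  apply/low_digits_agree; rewrite -n0c !low_digits_odometer.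
  by have /low_digits_agree -> := agm.
(* Otherwise [digits z] and [digits z'] would be congruent modulo [2 ^ m.+1], although they differ
   at [m]. *)
have dm : d m.
  apply/negPn/negP => /negbTE dm.
  have : agree m.+1 d cantor0.
    by move=> j; rewrite ltnS leq_eqVlt => /predU1P[->//|]; exact: dlow.
  move/low_digits_agree; rewrite -n0c !low_digits_odometer => /eqP.
  rewrite eqn_modDr !modn_small ?low_digits_lt// => /eqP/low_digits_agree/(_ m (ltnSn m)).
  by rewrite zm; case: (digits z m).
have vd : valuation d = m by apply: valuationP => // j jm; rewrite dlow.
have [d0|<-] := digits_marks z' n0; last by rewrite -/d vd om.
by rewrite -/d in d0; move: dm; rewrite d0.
Qed.

(** [U] contains all points over a cylinder of digits, and residues modulo [2 ^ m] recur with period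
    [2 ^ m], so the return times contain an arithmetic progression. *)
Lemma doubled_return (U : set doubled_odometer) : open U -> U !=set0 ->
  exists2 M, (0 < M)%N & forall z, exists r, forall n, U (iter (r + M * n) doubled_step z).
Proof.
move=> oU [z0 Uz0].
have [c0 [m mU]] := doubled_cylinder (open_nbhs_nbhs (conj oU Uz0)).
exists (2 ^ m)%N; first by rewrite expn_gt0.
(* The summand [2 ^ m] keeps the truncated subtraction from reaching 0. *)
move=> z; exists (low_digits m c0 + 2 ^ m - low_digits m (digits z))%N => n.
apply: mU; rewrite digits_iter; apply/low_digits_agree; rewrite low_digits_odometer.
have := low_digits_lt m (digits z); have := low_digits_lt m c0.
set a := low_digits m c0; set b := low_digits m (digits z) => al bl.
have -> : (b + (a + 2 ^ m - b + 2 ^ m * n) = (n.+1) * 2 ^ m + a)%N by lia.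
by rewrite modnMDl modn_small.
Qed.

Lemma regular_dense (U : set doubled_odometer) : open U -> U !=set0 ->
  exists2 z, U z & forall n, iter n odometer (digits z) <> cantor0.
Proof.
move=> oU [z0 Uz0].
have [c0 [m mU]] := doubled_cylinder (open_nbhs_nbhs (conj oU Uz0)).
(* A positive integer in the prescribed cylinder: adding natural numbers to it never gives 0. *)
pose c : cantor_space := fun j => if (j < m)%N then c0 j else j == m.
have [z dz] := doubled_over c.
exists z; first by apply: mU => j jm; rewrite dz /c jm.
move=> n; rewrite dz => /odometer_iter_eq0 H.
have lc k : low_digits (k + m.+1) c = (low_digits m c + 2 ^ m)%N.
  elim: k => [|k IH].
    by rewrite add0n low_digitsS {2}/c ltnn eqxx mul1n.
  have e1 : (k + m.+1 < m)%N = false by lia.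
  have e2 : (k + m.+1 == m)%N = false by lia.
  by rewrite addSn low_digitsS IH /c e1 e2 mul0n addn0.
have := H (low_digits m c + 2 ^ m + n + m.+1)%N; rewrite lc => /dvdn_leq.
set x := (_ + _ + n)%N => H'.
have p2 : (0 < 2 ^ m)%N by rewrite expn_gt0.
have /H' : (0 < x)%N by rewrite /x; lia.
by have := ltn_expl (x + m.+1) (isT : (1 < 2)%N); lia.
Qed.

Lemma doubled_hausdorff : hausdorff_space doubled_odometer.
Proof.
apply: set_type_hausdorff; apply: hausdorff_prod; exact: cantor_space_hausdorff.
Qed.

Lemma doubled_set_closed : closed doubled_set.
Proof.
rewrite -openC openE => p /existsNP[n /not_orP[c0 pn]].
have H1 := near_fst p.2 (continuous_odometer_iter (n := n) (valuation_locally_constant c0)).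
have H2 := near_snd p.1 (near_bit p.2 n).
rewrite -surjective_pairing in H1 H2.
apply: filterS2 H1 H2 => q [q0 qv] qn /(_ n)[//|].
by rewrite qv -qn => /pn.
Qed.

Lemma doubled_compact : compact [set: doubled_odometer].
Proof.
have cc := compact_setX cantor_space_compact cantor_space_compact.
apply: set_type_compact; rewrite setXTT in cc.
exact: (subclosed_compact doubled_set_closed cc).
Qed.

Lemma doubled_zero_dimensional : zero_dimensional doubled_odometer.
Proof.
move=> z z' zz'.
have [[n dn]|dE] := pselect (exists n, digits z n <> digits z' n).
  exists [set x | digits x n = digits z n]; split=> //; last by move=> /= /esym.
  by apply: bit_clopen => x; exact: near_digit.
have [[n mn]|mE] := pselect (exists n, marks z n <> marks z' n).
  exists [set x | marks x n = marks z n]; split=> //; last by move=> /= /esym.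
  by apply: bit_clopen => x; exact: near_mark.
exfalso; move/eqP : zz'; apply; apply: doubled_eq; apply/funext => n;
  apply: contrapT => h; [apply: dE|apply: mE]; by exists n.
Qed.

Lemma doubled_perfect : perfect_set [set: doubled_odometer].
Proof.
apply/perfectTP_ex => U oU [z0 Uz0].
have [c0 [m mU]] := doubled_cylinder (open_nbhs_nbhs (conj oU Uz0)).
have [x dx] := doubled_over (fun j => if (j < m)%N then c0 j else true).
have [y dy] := doubled_over (fun j => if (j < m)%N then c0 j else false).
exists x, y; split.
- by apply: mU => j jm; rewrite dx jm.
- by apply: mU => j jm; rewrite dy jm.
- by apply/eqP => /(congr1 digits)/(congr1 (fun c => c m)); rewrite dx dy ltnn.
Qed.

Lemma doubled_cantor (R : realType) : is_cantor_set (doubled_odometer : pseudoMetricType R).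
Proof.
have [z _] := doubled_over cantor0; apply: (@cantor_like_is_cantor_set R _ z).
split; [exact: doubled_perfect|exact: doubled_compact|exact: doubled_hausdorff|
  exact: doubled_zero_dimensional].
Qed.

(** * The skew product *)

Lemma circle_param_slice (R : realType) (X Y : topologicalType) (y : Y) (C : set X)
    (g : R -> X) :
  circle_param C g -> circle_param ([set y] `*` C) (fun t => (y, g t)).
Proof.
move=> [cg gE ->]; split.
- by apply: continuous_pair => //; exact: continuous_cst.
- by move=> t s; rewrite -gE; split=> [[]|->].
- by apply/seteqP; split=> [[_ _] [/= -> [t _ <-]]|_ [t _ <-]]; [exists t|split=> //; exists t].
Qed.

Section construction.
Context {R : realType} {G : pseudoMetricType R}.
Variables (g : bool -> R -> G) (C : bool -> set G).
Hypothesis gC : forall j, circle_param (C j) (g j).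
Hypothesis hG : hausdorff_space G.
Hypothesis cG : compact [set: G].
Variables (B : pseudoMetricType R) (A : topologicalType) (tau : A -> A) (o : A).
Variables (step : B -> B) (digits : B -> A) (mark : B -> bool).
Hypothesis hB : hausdorff_space B.
Hypothesis cB : compact [set: B].
Hypothesis cstep : continuous step.
Hypothesis cdigits : continuous digits.
Hypothesis near_mark : forall z, \forall z' \near z, mark z = mark z'.
Hypothesis tau_inj : injective tau.
Hypothesis digits_step : forall z, digits (step z) = tau (digits z).
Hypothesis collision : forall z z', step z = step z' -> mark z <> mark z' -> digits z = o.
Hypothesis step_eq : forall z z', digits z = o -> digits z' = o -> step z = step z'.
Hypothesis mark_exists : forall j, exists z, digits z = o /\ mark z = j.
Hypothesis return_times : forall U : set B, open U -> U !=set0 ->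
  exists2 m, (0 < m)%N & forall z, exists r, forall n, U (iter (r + m * n) step z).
Hypothesis regular_dense : forall U : set B, open U -> U !=set0 ->
  exists2 z, U z & forall n, iter n tau (digits z) <> o.
Variables (T psi : A -> R -> R) (a alpha : R).
Hypothesis cT : continuous (fun p : A * R => T p.1 p.2).
Hypothesis cpsi : continuous (fun p : A * R => psi p.1 p.2).
Hypothesis TD1 : forall c x, T c (x + 1) = T c x + 1.
Hypothesis psiD1 : forall c x, psi c (x + 1) = psi c x + 1.
Hypothesis psiT : forall c x, psi (tau c) (T c x) = psi c x + alpha.
Hypothesis psi_le : forall c x y, x <= y -> psi c x <= psi c y.
Hypothesis psi_lt : forall c x y,
  (forall n, iter n tau c <> o) -> x < y -> psi c x < psi c y.
Hypothesis T_flat : forall x, a <= x <= a + 1 / 2 -> T o x = T o a.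
Hypothesis irr_alpha : irrational alpha.
(** The free arc of each circle fills the second half of the period; [T o] is constant on the first
    half. *)
Let J j := g j @` `]a + 1 / 2, a + 1[.
Hypothesis openJ : forall j, open (J j).
Hypothesis JC : forall j, J j `&` C (~~ j) = set0.

Implicit Types (z y : B) (x t : R).

Let cg j : continuous (g j). Proof. by case: (gC j). Qed.
Let gE j t s : g j t = g j s <-> exists k : int, t = s + k%:~R.
Proof. by case: (gC j). Qed.
Let gp j t (k : int) : g j (t + k%:~R) = g j t.
Proof. by apply/gE; exists k. Qed.
Let Cg j t : C j (g j t). Proof. by case: (gC j) => _ _ ->; exists t. Qed.

(* Surjection onto the minimal set: over the image of the points with mark [j] the fibre
   is the circle [C j]. *)
Definition lap (p : B * R) : B * G := (step p.1, g (mark p.1) p.2).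

(* Lift of the circle map that collapses the complement of the free arc. *)
Definition kink x : R := Num.max 0 (2 * (x - a) - 1).

Lemma continuous_kink : continuous kink.
Proof.
apply: continuous_max_fun; first exact: continuous_cst.
apply: continuousB_fun; last exact: continuous_cst.
apply: continuousM_fun; first exact: continuous_cst.
by apply: continuousB_fun; [exact: continuous_idfun|exact: continuous_cst].
Qed.

Lemma continuous_by_mark (Y : topologicalType) (h : bool -> B * Y -> G) :
  (forall j, continuous (h j)) -> continuous (fun p => h (mark p.1) p).
Proof.
move=> ch [z u]; have := ch (mark z) (z, u).
apply: cvg_trans; apply: near_eq_cvg.
by apply: filterS (near_fst u (near_mark z)) => p <-.
Qed.

Lemma continuous_lap : continuous lap.
Proof.
apply: continuous_pair.
  apply: (continuous_compose (f := fst)); last exact: cstep.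
  by move=> p; exact: cvg_fst.
apply: (continuous_by_mark (h := fun j p => g j p.2)) => j.
apply: (continuous_compose (f := snd)) => // p; exact: cvg_snd.
Qed.

Let K : set (B * R) := [set: B] `*` `[a, a + 1].

Lemma compact_K : compact K.
Proof. by apply: compact_setX; [exact: cB|exact: segment_compact]. Qed.

Lemma lap_int z x (k : int) : lap (z, x + k%:~R) = lap (z, x).
Proof. by rewrite /lap /= gp. Qed.

Definition lap_set : set (B * G) := range lap.

Lemma lap_setE : lap_set = lap @` K.
Proof.
apply/seteqP; split=> [_ [[z x] _ <-]|_ [p _ <-]]; last by exists p.
have [k k01] := floor_frac (x - a).
exists (z, x - k%:~R); last by rewrite -[X in _ - X]opprK -mulrNz opprK mulrNz -mulrNz lap_int.
by split=> //=; rewrite in_itv/=; lra.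
Qed.

Lemma lap_set_compact : compact lap_set.
Proof.
rewrite lap_setE; apply: continuous_compact compact_K.
by apply: continuous_subspaceT; exact: continuous_lap.
Qed.

Lemma hausdorff_BG : hausdorff_space (B * G)%type.
Proof. by apply: hausdorff_prod => //; exact: hB. Qed.

Lemma lap_set_closed : closed lap_set.
Proof. exact: compact_closed hausdorff_BG lap_set_compact. Qed.

Lemma arc_other j x : a <= x <= a + 1 -> C (~~ j) (g j x) -> x <= a + 1 / 2 \/ x = a + 1.
Proof.
move=> xa Cx; have [|xh] := leP x (a + 1 / 2); first by left.
right; have [x1|x1] := ltP x (a + 1); last by lra.
have : (J j `&` C (~~ j)) (g j x) by split=> //; exists x => //=; rewrite in_itv/= xh.
by rewrite JC.
Qed.

(** Both terms grow by 1 from [a] to [a + 1], so their difference has degree zero and can become a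
    real function on the minimal set. *)
Let drift (p : B * R) : R := T (digits p.1) p.2 - kink p.2.

Lemma drift_other z x : a <= x <= a + 1 -> digits z = o ->
  C (~~ mark z) (g (mark z) x) -> drift (z, x) = T o a.
Proof.
move=> xa z0 /(arc_other xa)[xh|->]; rewrite /drift /= z0 /kink.
  by rewrite T_flat ?max_l; lra.
by rewrite TD1 max_r; lra.
Qed.

(** Different marks force the digits to be [o] and the point to lie on both circles, where
    [drift_other] gives a common value. With equal marks the parameters coincide or are the two ends
    of the period. *)
Lemma drift_compatible p p' : K p -> K p' -> lap p = lap p' -> drift p = drift p'.
Proof.
move: p p' => [z x] [z' x'] [_ /=]; rewrite in_itv/= => xa [_ /=]; rewrite in_itv/= => xa'.
rewrite /lap /= => -[ss gg].
have dd : digits z = digits z' by apply: tau_inj; rewrite -!digits_step ss.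
have [m|m] := eqVneq (mark z) (mark z'); last first.
  have z0 : digits z = o by apply: collision ss _; apply/eqP.
  have m' : mark z' = ~~ mark z.
    by move: m; case: (mark z); case: (mark z').
  rewrite !drift_other// -?dd//; first by rewrite -gg m' negbK; exact: Cg.
  by rewrite gg -m'; exact: Cg.
move: gg; rewrite -m => /gE[k xk]; rewrite /drift /= -dd.
have : (-1 <= k <= 1)%R.
  by rewrite -!(ler_int R) mulrNz; move: xk xa xa'; lra.
have [k0|k0|k0] := ltgtP k 0.
- move=> /andP[k1 _]; have e : k = -1 by lia.
  have -> : x = a by move: xk; rewrite e mulrNz; lra.
  have -> : x' = a + 1 by move: xk; rewrite e mulrNz; lra.
  by rewrite TD1 /kink max_l ?max_r; lra.
- move=> /andP[_ k1]; have e : k = 1 by lia.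
  have -> : x = a + 1 by move: xk; rewrite e; lra.
  have -> : x' = a by move: xk; rewrite e; lra.
  by rewrite TD1 /kink max_r ?max_l; lra.
by move=> _; rewrite xk k0 addr0.
Qed.

Lemma continuous_drift : continuous drift.
Proof.
apply: continuousB_fun; last first.
  by apply: (continuous_compose (f := snd)); [move=> p; exact: cvg_snd|exact: continuous_kink].
apply: (continuous_compose (f := fun p : B * R => (digits p.1, p.2)) _ cT).
apply: continuous_pair; last by move=> p; exact: cvg_snd.
by apply: (continuous_compose (f := fst)); [move=> p; exact: cvg_fst|exact: cdigits].
Qed.

(** [drift] descends to the closed set [lap_set], is bounded there by compactness, and extends by
    Tietze's theorem. *)
Lemma drift_extension : exists r : B * G -> R,
  continuous r /\ forall z x, a <= x <= a + 1 -> r (lap (z, x)) = drift (z, x).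
Proof.
pose h (w : B * G) := if pselect (exists p, K p /\ lap p = w) is left e then drift (projT1 (cid e)) else 0.
have hE p : K p -> h (lap p) = drift p.
  move=> Kp; rewrite /h; case: pselect => [e|[]]; last by exists p.
  by case: cid => p' [Kp' pp'] /=; exact: drift_compatible.
have ch : {within lap_set, continuous h}.
  rewrite lap_setE; apply: (compact_descent hausdorff_BG compact_K _ _ hE).
    by apply: continuous_subspaceT; exact: continuous_lap.
  by apply: continuous_subspaceT; exact: continuous_drift.
have : compact (drift @` K).
  apply: continuous_compact compact_K.
  by apply: continuous_subspaceT; exact: continuous_drift.
move/compact_bounded => [M [_ /(_ (`|M| + 1))]].
have Ml : M < `|M| + 1 by have := ler_norm M; lra.
move=> /(_ Ml) bM; have M0 : 0 < `|M| + 1 by have := normr_ge0 M; lra.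
have nBG : normal_space (B * G)%type.
  apply: compact_normal hausdorff_BG _.
  by rewrite -setXTT; apply: compact_setX => //; exact: cB.
have [|r [rh cr _]] := continuous_bounded_extension nBG lap_set_closed M0 ch.
  by rewrite lap_setE => _ [p Kp <-]; rewrite hE//; apply: bM; exists p.
exists r; split=> // z x xa; rewrite -rh; last by rewrite inE; exists (z, x).
by apply: hE; split=> //=; rewrite in_itv.
Qed.

(* Agrees modulo 1 with [kink] on both circles, so that the map to the circle it induces is
   continuous on the whole graph although [wrap] is not. *)
Definition wrap (p : G) : R :=
  if pselect (exists x, (exists j, g j x = p) /\ a + 1 / 2 < x < a + 1) is left e
  then 2 * (projT1 (cid e) - a) - 1 else 0.

Lemma J_arc j j' x x' : a <= x <= a + 1 -> a + 1 / 2 < x' < a + 1 ->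
  g j x = g j' x' -> j = j' /\ x = x'.
Proof.
move=> xa xa' gg; have [e|ne] := eqVneq j j'.
  split=> //; move: gg; rewrite -e => /gE[k xk].
  have k1 : (-1 < k < 1)%R by rewrite -!(ltr_int R) mulrNz; lra.
  have k0 : k = 0 by lia.
  by rewrite xk k0 addr0.
exfalso; have : (J j' `&` C (~~ j')) (g j' x').
  split; first by exists x' => //=; rewrite in_itv/=.
  by rewrite -gg (_ : ~~ j' = j); [exact: Cg|case: (j) (j') ne => -[]].
by rewrite JC.
Qed.

(** The integer is nonzero only at the end [x = a + 1], where [kink] is 1 but [wrap] has already
    dropped to 0. *)
Lemma wrapE j x : a <= x <= a + 1 -> exists k : int, wrap (g j x) = kink x + k%:~R.
Proof.
move=> xa; rewrite /wrap; case: pselect => [e|ne] /=.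
  case: cid => x' [[j' gg] xa'] /=.
  have [_ ->] := J_arc xa xa' (esym gg).
  by exists 0; rewrite addr0 /kink max_r; lra.
have [xh|xh] := leP x (a + 1 / 2).
  by exists 0; rewrite addr0 /kink max_l; lra.
have -> : x = a + 1.
  have [x1|] := ltP x (a + 1); last by lra.
  by exfalso; apply: ne; exists x; split; [exists j|rewrite xh].
by exists (-1); rewrite mulrNz /kink max_r; lra.
Qed.

Lemma wrap_out p : (forall j, ~ J j p) -> wrap p = 0.
Proof.
move=> Jp; rewrite /wrap; case: pselect => // -[x [[j xp] xa]].
by exfalso; apply: (Jp j); exists x => //=; rewrite in_itv/=.
Qed.

Section fibre_map.
Variable r : B * G -> R.
Hypothesis cr : continuous r.
Hypothesis rE : forall z x, a <= x <= a + 1 -> r (lap (z, x)) = drift (z, x).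

Let turn j (p : B * G) : G := g j (wrap p.2 + r p).

(** Pasting over three closed sets: the products of [B] with the two closed free arcs and with the
    complement of the open ones. On an arc the map descends from the parameter interval, the jump of
    [wrap] being an integer absorbed by [g j]. *)
Lemma continuous_turn j : continuous (turn j).
Proof.
apply/continuous_subspace_setT.
pose I := `[a + 1 / 2, a + 1]%classic.
pose D k : set (B * G) := (fun q : B * R => (q.1, g k q.2)) @` ([set: B] `*` I).
pose D0 : set (B * G) := snd @^-1` (~` (J true `|` J false)).
have cq k : continuous (fun q : B * R => (q.1, g k q.2)).
  apply: continuous_pair; first by move=> q; exact: cvg_fst.
  by apply: (continuous_compose (f := snd)) => // q; exact: cvg_snd.
have cI : compact ([set: B] `*` I) by apply: compact_setX => //; exact: segment_compact.
have clD k : closed (D k).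
  apply: compact_closed hausdorff_BG _; apply: continuous_compact cI.
  by apply: continuous_subspaceT; exact: cq.
have clD0 : closed D0.
  apply: closed_preimage; first by move=> p; exact: cvg_snd.
  by apply: open_closedC; apply: openU; exact: openJ.
have cD k : {within D k, continuous (turn j)}.
  apply: (@compact_descent _ _ _ _ _ (fun q => g j (2 * (q.2 - a) - 1 + r (q.1, g k q.2)))
    _ hausdorff_BG cI).
  - by apply: continuous_subspaceT; exact: cq.
  - apply: continuous_subspaceT; apply: continuous_compose (cg (j := j)).
    apply: continuousD_fun; last exact: continuous_compose (cq k) cr.
    apply: continuousB_fun; last exact: continuous_cst.
    apply: continuousM_fun; first exact: continuous_cst.
    by apply: continuousB_fun; [move=> q; exact: cvg_snd|exact: continuous_cst].
  - move=> [y x] [_]; rewrite /I /= in_itv/= => xa; rewrite /turn /=.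
    have [|k' ->] := @wrapE k x; first by lra.
    by rewrite addrAC gp /kink max_r //; lra.
have cD0 : {within D0, continuous (turn j)}.
  have c0 : {within D0, continuous (fun p => g j (0 + r p))}.
    apply: continuous_subspaceT; apply: continuous_compose (cg (j := j)).
    by apply: continuousD_fun => //; exact: continuous_cst.
  apply: subspace_eq_continuous c0 => p; rewrite inE /D0 /= => /not_orP[n1 n2].
  have e : wrap p.2 = 0 by apply: wrap_out => -[].
  by rewrite /from_subspace /turn e.
have -> : [set: B * G] = D true `|` D false `|` D0.
  apply/seteqP; split=> // -[y p] _; have [Jp|] := pselect (D0 (y, p)); first by right.
  rewrite /D0 /= => /contrapT H; left.
  case: H => -[x /=]; rewrite in_itv/= => xa <-; [left|right]; exists (y, x) => //;
    by split=> //=; rewrite /I /= in_itv/=; lra.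
apply: withinU_continuous => //; first exact: closedU.
exact: withinU_continuous.
Qed.

Let F (p : B * G) : B * G := (step p.1, turn (mark p.1) p).

Lemma continuous_F : continuous F.
Proof.
apply: continuous_pair.
  apply: (continuous_compose (f := fst)) => // p; exact: cvg_fst.
by apply: continuous_by_mark => j; exact: continuous_turn.
Qed.

(** On the period [a, a + 1], [wrap] plus the extension [r] is [kink] plus [drift] up to an integer,
    that is [T]. Both sides are 1-periodic in [x]. *)
Lemma F_lap z x : F (lap (z, x)) = lap (step z, T (digits z) x).
Proof.
wlog xa : x / a <= x <= a + 1 => [H|].
  have [k k01] := floor_frac (x - a).
  have := H (x - k%:~R); rewrite -mulrNz lap_int equivariant_int// lap_int; apply.
  by rewrite mulrNz; lra.
rewrite /F {1}/lap /=; congr pair; rewrite /turn rE// {1}/lap /=.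
have [k ->] := wrapE (mark z) xa.
by rewrite /drift /= addrAC gp addrC subrK.
Qed.

Lemma F_lap_iter n z x : exists x', iter n F (lap (z, x)) = lap (iter n step z, x') /\
  psi (digits (iter n step z)) x' = psi (digits z) x + n%:R * alpha.
Proof.
elim: n => [|n [x' [e ph]]]; first by exists x; rewrite mul0r addr0.
exists (T (digits (iter n step z)) x'); rewrite iterS e F_lap; split=> //.
by rewrite /= digits_step psiT ph -natr1; ring.
Qed.

Lemma lap_set_invariant : F @` lap_set `<=` lap_set.
Proof. by move=> _ [_ [[z x] _ <-] <-]; rewrite F_lap; eexists. Qed.

(** Over a regular [z1] the phase is strictly increasing, so for base points near [z1] a phase close
    to [t1] forces the parameter close to [x1]. It remains to make base point and phase approach
    simultaneously. *)
Lemma lap_orbit_approaches z x z1 x1 (W : set (B * R)) :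
  (forall n, iter n tau (digits z1) <> o) -> nbhs (z1, x1) W ->
  exists n z' x', W (z', x') /\ iter n F (lap (z, x)) = lap (z', x').
Proof.
move=> rz1 [[U V] /= [nU /nbhs_ballP[e /= e0 eV]] UV].
have cP t : continuous (fun z : B => psi (digits z) t).
  apply: (continuous_compose (f := fun z : B => (digits z, t)) _ cpsi).
  by apply: continuous_pair => //; exact: continuous_cst.
set t1 := psi (digits z1) x1.
have p1 : psi (digits z1) (x1 - e / 2) < t1 by apply: psi_lt => //; lra.
have p2 : t1 < psi (digits z1) (x1 + e / 2) by apply: psi_lt => //; lra.
pose d := Num.min ((t1 - psi (digits z1) (x1 - e / 2)) / 2)
                  ((psi (digits z1) (x1 + e / 2) - t1) / 2).
have d0 : 0 < d by rewrite lt_min; apply/andP; split; lra.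
have d1 : psi (digits z1) (x1 - e / 2) < t1 - d.
  have : d <= (t1 - psi (digits z1) (x1 - e / 2)) / 2 by rewrite /d ge_min lexx.
  by lra.
have d2 : t1 + d < psi (digits z1) (x1 + e / 2).
  have : d <= (psi (digits z1) (x1 + e / 2) - t1) / 2 by rewrite /d ge_min lexx orbT.
  by lra.
have N1 := cvgr_lt _ (cP (x1 - e / 2) z1) _ d1.
have N2 := cvgr_gt _ (cP (x1 + e / 2) z1) _ d2.
have [U0 [oU0 Uz1 U0P]] : exists U0 : set B, [/\ open U0, U0 z1 & forall y, U0 y ->
    [/\ U y, psi (digits y) (x1 - e / 2) < t1 - d & t1 + d < psi (digits y) (x1 + e / 2)]].
  have : \forall y \near z1, [/\ U y, psi (digits y) (x1 - e / 2) < t1 - d &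
       t1 + d < psi (digits y) (x1 + e / 2)].
    near=> y; split; near: y; [exact: nU|exact: N1|exact: N2].
  by rewrite /prop_near1 nbhsE => -[U0 [oU0 U0z1] U0P]; exists U0.
(* Along the return times [s + m * n] the phase rotates by [m * alpha], which is still irrational,
   so it comes within [d] of [t1] modulo 1. *)
have [|m m0 /(_ z)[s sU]] := return_times oU0; first by exists z1.
have [n [k nk]] := irrational_dense (psi (digits z) x + s%:R * alpha) t1
  (irrationalMn m0 irr_alpha) d0.
have [x' [xe ph]] := F_lap_iter (s + m * n) z x.
exists (s + m * n)%N, (iter (s + m * n) step z), (x' + k%:~R); split; last first.
  by rewrite lap_int.
have [Uy y1 y2] := U0P _ (sU n).
apply: UV; split=> //=; apply: eV.
set y := iter _ _ z in y1 y2 ph *.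
have phk : psi (digits y) (x' + k%:~R) = psi (digits y) x' + k%:~R by exact: equivariant_int.
have ph1 : `|psi (digits y) (x' + k%:~R) - t1| < d.
  by rewrite phk ph natrD natrM; move: nk; congr (`| _ | < _); ring.
have lo : x1 - e / 2 < x' + k%:~R.
  rewrite ltNge; apply/negP => /(psi_le (digits y)) h.
  by move: ph1; rewrite ltr_norml; lra.
have hi : x' + k%:~R < x1 + e / 2.
  rewrite ltNge; apply/negP => /(psi_le (digits y)) h.
  by move: ph1; rewrite ltr_norml; lra.
by rewrite /ball /= ltr_norml; lra.
Unshelve. all: by end_near. Qed.

(** The preimage under [lap] of a closed invariant set meeting [lap_set] is closed and contains
    every point over a regular base point; those points are dense. *)
Lemma lap_set_minimal : minimal_on F lap_set.
Proof.
move=> N NM [p Np] clN FN; apply/seteqP; split=> // _ [[z1 x1] _ <-].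
have [[z x] _ zx] := NM _ Np.
have iN n : N (iter n F (lap (z, x))).
  by elim: n => [|n IH]; [rewrite zx|apply: FN; exists (iter n F (lap (z, x)))].
pose N' : set (B * R) := lap @^-1` N.
have clN' : closed N' by exact: closed_preimage continuous_lap clN.
have regN z2 x2 : (forall n, iter n tau (digits z2) <> o) -> N' (z2, x2).
  move=> rz2; apply: clN' => W /(lap_orbit_approaches z x rz2)[n [z' [x' [Wz' e]]]].
  by exists (z', x'); split=> //; rewrite /N' /= -e.
apply: (clN' (z1, x1)) => W [[U V] /= [nU nV] UV].
have [U' [oU' U'z1] U'U] : exists2 U' : set B, open_nbhs z1 U' & U' `<=` U.
  by move: nU; rewrite nbhsE.
have [|z2 U'z2 rz2] := regular_dense oU'; first by exists z1.
exists (z2, x1); split; first exact: regN.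
by apply: UV; split=> /=; [exact: U'U|exact: nbhs_singleton].
Qed.

End fibre_map.

Lemma step_minimal : minimal_on step [set: B].
Proof.
move=> N _ [z Nz] cN NN; apply/seteqP; split=> // y _; apply: contrapT => Ny.
have [] := @return_times (~` N); [exact: closed_openC|by exists y|].
move=> m m0 /(_ z)[s /(_ 0%N)]; apply.
by elim: (_ + _)%N => //= n IH; apply: NN; exists (iter n step z).
Qed.

(** The range is closed and invariant, hence everything by minimality. *)
Lemma step_surj y : exists z, step z = y.
Proof.
have cl : closed (range step).
  apply: compact_closed hB _; apply: continuous_compact cB.
  by apply: continuous_subspaceT; exact: cstep.
have [z0 _] := mark_exists true.
have : [set: B] y by [].
rewrite -(step_minimal _ _ cl _)//.
- by move=> [z _ <-]; exists z.
- by exists (step z0), z0.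
- by move=> _ [_ [z _ <-] <-]; exists (step z).
Qed.

Lemma fibre_lap y z : step z = y -> digits z <> o ->
  fibre lap_set y = [set y] `*` C (mark z).
Proof.
move=> zy zo; have [_ _ Ceq] := gC (mark z).
apply/seteqP; split=> [_ [[[z' x] _ <-] /= z'y]|[y' p] [/= ->]].
  split=> //=; have -> : mark z = mark z'.
    by apply: contra_notP zo; apply: collision; rewrite zy.
  exact: Cg.
by rewrite Ceq => -[x _ <-]; split=> //; exists (z, x) => //; rewrite /lap /= zy.
Qed.

Lemma fibre_lap0 z : digits z = o ->
  fibre lap_set (step z) = [set step z] `*` (C true `|` C false).
Proof.
move=> z0; apply/seteqP; split=> [_ [[[z' x] _ <-] /= z'y]|[y' p] [/= ->]].
  by split=> //=; case: (mark z'); [left|right]; exact: Cg.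
move=> Cp; have [j Cjp] : exists j, C j p by case: Cp; [exists true|exists false].
have [z' [z'0 mj]] := mark_exists j.
have [_ _ Ceq] := gC (mark z'); move: Cjp; rewrite -mj Ceq => -[x _ <-].
by split=> //; exists (z', x) => //; rewrite /lap /= (step_eq z'0 z0).
Qed.

Lemma skew_system_construction (P : forall (B G : pseudoMetricType R), set (B * G) -> Prop) :
  is_cantor_set B -> is_graph G -> connected [set: G] ->
  (forall b : B, P B G ([set b] `*` (C true `|` C false))) -> skew_system_exists P.
Proof.
move=> cantB grG conG PB; have [r [cr rE]] := drift_extension.
have [z0 [z00 _]] := mark_exists true.
exists B, G, step, (fun p : B * G => (step p.1, g (mark p.1) (wrap p.2 + r p))), lap_set, (step z0).
split=> //; split; first by split=> //; exact: step_minimal.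
split=> //; split=> //; split; first exact: continuous_F cr.
split=> //; split.
  split.
  - by exists (lap (z0, 0)), (z0, 0).
  - exact: lap_set_closed.
  - exact: lap_set_invariant rE.
  - exact: lap_set_minimal rE.
split; last by rewrite fibre_lap0.
move=> y yb; have [z zy] := step_surj y.
have zo : digits z <> o by move=> zo; apply: yb; rewrite -zy (step_eq zo z00).
rewrite (fibre_lap zy zo); apply: (circle_param_is_circle hausdorff_BG).
exact: circle_param_slice.
Qed.
End construction.

Lemma circle_param_shift (R : realType) (X : topologicalType) (C : set X) (g : R -> X)
    (a : R) :
  circle_param C g -> circle_param C (fun t => g (t - a)).
Proof.
move=> [cg gE Cg]; split.
- apply: continuous_compose cg.
  by apply: continuousB_fun; [exact: continuous_idfun|exact: continuous_cst].
- by move=> t s; rewrite gE; split=> -[k e]; exists k; lra.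
- rewrite Cg; apply/seteqP; split=> _ [t _ <-]; last by exists (t - a).
  by exists (t + a) => //; rewrite addrK.
Qed.

Lemma skew_system_of_circles (R : realType) (G : pseudoMetricType R)
    (C : bool -> set G) (g : bool -> R -> G)
    (P : forall (B G : pseudoMetricType R), set (B * G) -> Prop) :
  is_graph G -> connected [set: G] ->
  (forall j, circle_param (C j) (g j)) ->
  (forall j, open (g j @` `]1 / 2, 1[)) ->
  (forall j, g j @` `]1 / 2, 1[ `&` C (~~ j) = set0) ->
  (forall (B : pseudoMetricType R) (b : B),
     hausdorff_space B -> P B G ([set b] `*` (C true `|` C false))) ->
  skew_system_exists P.
Proof.
move=> grG conG gC oJ JC PB; have [hG cG _ _] := grG.
have cod := continuous_odometer; have oN := odometer0_aperiodic.
have vl := valuation_locally_constant; have vi := valuation_infty.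
pose alpha : R := Num.sqrt 2.
have [a flat] := shift_lift_flat alpha cod oN vl vi.
(* Shifting the parametrizations by [a] aligns the flat interval of the lift with the complement of
   the free arcs. *)
have JE j : (fun t => g j (t - a)) @` `]a + 1 / 2, a + 1[ = g j @` `]1 / 2, 1[.
  apply/seteqP; split=> _ [t + <-]; rewrite /= in_itv/= => ta.
    by exists (t - a) => //=; rewrite in_itv/=; lra.
  by exists (t + a); rewrite ?addrK//= in_itv/=; lra.
apply: (@skew_system_construction R G (fun j t => g j (t - a)) C _ hG cG
  (set_type doubled_set) cantor_space odometer cantor0 doubled_step digits
  (fun z => marks z 0%N) doubled_hausdorff doubled_compact continuous_doubled_step
  continuous_digits (fun z => near_mark z 0) odometer_inj _ doubled_step_collision _
  doubled0_exists doubled_return regular_dense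
  (shift_lift alpha cod vl vi) (phase alpha cod vl vi) a alpha).
- by move=> j; exact: circle_param_shift.
- exact: digits_step.
- by move=> z z' z0 z'0; apply: doubled_step_eq => //; rewrite z0 z'0.
- exact: continuous_shift_lift.
- exact: continuous_phase.
- exact: shift_liftD1.
- exact: phaseD1.
- exact: phase_shift.
- exact: phase_le.
- by move=> c x y; exact: phase_regular_lt.
- exact: flat.
- exact: irrational_sqrt2.
- by move=> j; rewrite /= JE.
- by move=> j; rewrite /= JE.
- exact: doubled_cantor.
- exact: grG.
- exact: conG.
- by move=> b; apply: PB; exact: doubled_hausdorff.
Qed.

(** * Arcs and circles in graphs *)

Section circles_in_graphs.
Context {R : realType}.

Lemma injective_image_oo (f : R -> R) (u v : R) : u < v ->
  {within `[u, v], continuous f} -> {in `[u, v] &, injective f} ->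
  f @` `]u, v[ = `]Num.min (f u) (f v), Num.max (f u) (f v)[%classic.
Proof.
move=> uv cf fi; have fE := continuous_inj_image_segment (ltW uv) cf fi.
have uI : u \in `[u, v] by rewrite in_itv/= lexx ltW.
have vI : v \in `[u, v] by rewrite in_itv/= lexx ltW.
apply/seteqP; split=> [_ [x xI <-]|y yI].
  have xI' : x \in `[u, v] by move: xI; rewrite /= !in_itv/=; lra.
  have : (f @` `[u, v]) (f x) by exists x.
  have xu : f x != f u.
    by apply/eqP => /fi e; move: xI; rewrite /= in_itv/= e//; lra.
  have xv : f x != f v.
    by apply/eqP => /fi e; move: xI; rewrite /= in_itv/= e//; lra.
  rewrite fE /= !in_itv/= => /andP[h1 h2]; rewrite !lt_neqAle h1 h2 !andbT.
  by rewrite eq_sym; apply/andP; split; [case: (leP (f u) (f v)) | case: (leP (f u) (f v))].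
have : (f @` `[u, v]) y.
  by rewrite fE; move: yI; rewrite /= !in_itv/= => /andP[h1 h2]; rewrite !ltW.
move=> [x xI fx]; exists x => //; move: xI yI; rewrite /= !in_itv/= -fx => /andP[ux xv].
move=> /andP[h1 h2]; rewrite !lt_neqAle ux xv !andbT; apply/andP; split.
  apply/eqP => e; move: h1 h2; rewrite -e.
  by rewrite gt_min lt_max !ltxx /= ?orbF => h1 h2; lra.
apply/eqP => e; move: h1 h2; rewrite e.
by rewrite gt_min lt_max !ltxx /= ?orbF => h1 h2; lra.
Qed.

(** The mean of [h 0] and [h (1 / 2)] is attained on both halves of [0, 1]. Injectivity modulo 1
    puts these parameters at 1/2 or at the ends, making the two values equal. *)
Lemma no_circle_in_line (h : R -> R) : continuous h -> h 0 = h 1 ->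
  ~ (forall t s, h t = h s -> exists k : int, t = s + k%:~R).
Proof.
move=> ch h01 hi; pose m := (h 0 + h (1 / 2)) / 2.
have h0h : h 0 <> h (1 / 2).
  move=> /hi[k]; have : (k <= -1 \/ 0 <= k)%R by lia.
  by case; rewrite -(ler_int R) ?mulrNz; lra.
have [c1 c1I hc1] : exists2 c, c \in `[0, 1 / 2] & h c = m.
  apply: IVT; [lra|exact: continuous_subspaceT|].
  by rewrite ge_min le_max /m; case: (leP (h 0) (h (1 / 2))) => ?; lra.
have [c2 c2I hc2] : exists2 c, c \in `[1 / 2, 1] & h c = m.
  apply: IVT; [lra|exact: continuous_subspaceT|].
  by rewrite -h01 ge_min le_max /m; case: (leP (h 0) (h (1 / 2))) => ?; lra.
move: c1I c2I; rewrite !in_itv/= => c1I c2I.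
have [k ck] := hi c1 c2 (etrans hc1 (esym hc2)).
have k1 : (-1 <= k <= 0)%R by rewrite -!(ler_int R) mulrNz; lra.
have [k0|k0] : k = 0 \/ k = -1 by lia.
  have e : c1 = 1 / 2 by move: ck; rewrite k0; lra.
  by apply: h0h; move: hc1; rewrite e /m; lra.
have e : c1 = 0 by move: ck; rewrite k0 mulrNz; lra.
by apply: h0h; move: hc1; rewrite e /m; lra.
Qed.

(** Cutting [C'] at a point missed by [C] would embed the circle [C] in an interval, against
    [no_circle_in_line]. *)
Lemma circle_not_proper (X : topologicalType) (C C' : set X) g g' :
  hausdorff_space X -> circle_param C (g : R -> X) -> circle_param C' (g' : R -> X) ->
  C `<=` C' -> C = C'.
Proof.
move=> hX gC gC' CC'; apply/seteqP; split=> // p C'p; apply: contrapT => Cp.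
have [cg gE Cg] := gC; have [cg' gE' Cg'] := gC'.
move: C'p; rewrite Cg' => -[y0 _ y0p].
pose D := `[y0, y0 + 1] `&` g' @^-1` C.
have clC : closed C by apply: compact_closed => //; exact: circle_param_compact gC.
have cD : compact D.
  by apply: compact_closedI; [exact: segment_compact|exact: closed_preimage].
have D1 x : D x -> y0 < x < y0 + 1.
  move=> [/=]; rewrite in_itv/= => xI Cx; rewrite !lt_neqAle.
  have -> : y0 != x by apply/eqP => e; apply: Cp; rewrite -y0p e.
  have -> : x != y0 + 1.
    apply/eqP => e; apply: Cp; rewrite -y0p; have <- // : g' x = g' y0.
    by apply/gE'; exists 1.
  by rewrite xI.
have [g1 [_ [cg1 [_ [_ [_ fK]]]]]] : exists g1, homeo D (g' @` D) g' g1.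
  apply: (compact_inj_homeo 0 hX cD); first exact: continuous_subspaceT.
  move=> x y; rewrite !inE => /D1 xI /D1 yI /gE'[k xk].
  have k1 : (-1 < k < 1)%R by rewrite -!(ltr_int R) mulrNz; lra.
  have k0 : k = 0 by move: k1; clear; lia.
  by rewrite xk k0 addr0.
have CD t : (g' @` D) (g t).
  have [_] : C' (g t) /\ C (g t) by split; [apply: CC'|]; rewrite Cg; exists t.
  have : C' (g t) by apply: CC'; rewrite Cg; exists t.
  rewrite [in X in X -> _](circle_param_itv y0 gC') => -[x xI xt] Ct.
  by exists x => //; split=> //=; rewrite xt.
have ch : continuous (g1 \o g) by exact: continuous_comp_within cg CD cg1.
apply: (no_circle_in_line ch).
  by rewrite /=; congr g1; apply/gE; exists (-1); rewrite mulrNz; lra.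
by move=> t s /= /(congr1 g'); rewrite !fK// => /gE.
Qed.

(** In an open interval of length at most 1 each point has at most one parameter, so one open half
    avoids it; halve once per point. *)
Lemma avoid_points (X : choiceType) (g : R -> X) (s : seq X) (u v : R) :
  (forall t s, g t = g s -> exists k : int, t = s + k%:~R) -> u < v -> v - u <= 1 ->
  exists u' v', [/\ u <= u', u' < v', v' <= v &
    forall x, u' < x < v' -> g x \notin s].
Proof.
move=> gi; elim: s u v => [|p s IH] u v uv uv1.
  by exists u, v; split=> // x _.
have [u' [v' [u1 v1 v2 H]]] := IH u v uv uv1.
pose m := (u' + v') / 2.
have [[x [xI xp]]|no] := pselect (exists x, u' < x < m /\ g x = p).
  exists m, v'; split; rewrite /m; try lra.
  move=> y yI; rewrite in_cons negb_or H ?andbT; last by lra.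
  apply/eqP => yp; have [k yk] := gi y x (etrans yp (esym xp)).
  have k1 : (0 < k < 1)%R by rewrite -!(ltr_int R); move: xI; rewrite /m; lra.
  by lia.
exists u', m; split; rewrite /m; try lra.
move=> y yI; rewrite in_cons negb_or H ?andbT; last by lra.
by apply/eqP => yp; apply: no; exists y.
Qed.

Lemma circle_reparam (X : topologicalType) (C : set X) (g : R -> X) (rho : R -> R) :
  circle_param C g -> continuous rho -> (forall t s, t < s -> rho t < rho s) ->
  (forall t, rho (t + 1) = rho t + 1) -> circle_param C (g \o rho).
Proof.
move=> [cg gE ->] cr rlt rD.
have rk (k : int) t : rho (t + k%:~R) = rho t + k%:~R.
  exact: equivariant_int.
have ri : injective rho.
  by move=> t s e; have [/rlt|/rlt|//] := ltgtP t s; rewrite e ltxx.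
split; first exact: continuous_compose cr cg.
  move=> t s; rewrite /= gE; split=> -[k e]; exists k; first by apply: ri; rewrite rk.
  by rewrite e rk.
apply/seteqP; split=> [_ [t _ <-]|_ [t _ <-]]; last by exists (rho t).
have [k /andP[k0 k1]] := floor_frac (t - rho 0).
have [|x _ xE] := @IVT R rho 0 1 (t - k%:~R) ler01 (continuous_subspaceT cr).
  by have := rD 0; rewrite add0r => ->; rewrite ge_min le_max; lra.
exists (x + k%:~R) => //=; rewrite rk xE subrK //.
Qed.
End circles_in_graphs.

Section graph_arcs.
Context {R : realType} {X : pseudoMetricType R}.

Lemma arc_param_inj (f : R -> X) :
  is_arc_param f -> {within @unit_interval R, continuous f} /\
    {in @unit_interval R &, injective f}.
Proof.
move=> [g [cf [_ [_ [_ [gf _]]]]]]; split=> // x y; rewrite !inE => xI yI.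
by move=> /(congr1 g); rewrite !gf.
Qed.

Lemma arc_image_compact (f : R -> X) (u v : R) : is_arc_param f -> 0 <= u -> v <= 1 ->
  compact (f @` `[u, v]).
Proof.
move=> /arc_param_inj[cf _] u0 v1; apply: continuous_compact; last exact: segment_compact.
apply: continuous_subspaceW cf => x; rewrite /unit_interval /= !in_itv/=; lra.
Qed.

Variables (n : nat) (arcs : 'I_n -> R -> X).
Hypothesis hX : hausdorff_space X.
Hypothesis arcP : forall i, is_arc_param (arcs i).
Hypothesis arc_cover : [set: X] = \bigcup_(i in [set: 'I_n]) (arcs i @` @unit_interval R).
Hypothesis arc_meet : forall i j, i <> j ->
  (arcs i @` @unit_interval R) `&` (arcs j @` @unit_interval R)
    `<=` arc_endpoints (arcs i) `&` arc_endpoints (arcs j).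

(** The complement is a finite union of compact sets: the other arcs and the two end pieces of this
    one. *)
Lemma open_subarc k (u v : R) : 0 <= u -> u <= v -> v <= 1 -> open (arcs k @` `]u, v[).
Proof.
move=> u0 uv v1; have [_ fi] := arc_param_inj (arcP k).
have unitE (x : R) : (@unit_interval R) x = (0 <= x <= 1) by rewrite /unit_interval /= in_itv.
suff -> : arcs k @` `]u, v[ = ~` ((\bigcup_(i in [set i | i <> k]) (arcs i @` @unit_interval R))
    `|` (arcs k @` `[0, u] `|` arcs k @` `[v, 1])).
  apply: closed_openC; apply: closedU.
    apply: closed_bigcup; first exact: finite_finset.
    by move=> i _; apply: compact_closed hX (arc_image_compact (arcP i) _ _).
  by apply: closedU; apply: compact_closed hX (arc_image_compact (arcP k) _ _); lra.
have ki x y : 0 <= x <= 1 -> 0 <= y <= 1 -> arcs k x = arcs k y -> x = y.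
  by move=> x01 y01; apply: fi; rewrite inE unitE.
apply/seteqP; split=> [_ [x + <-]|p].
  rewrite /= in_itv/= => xI; case=> [[i ik [y yI e]]|].
    have : (arcs i @` @unit_interval R `&` arcs k @` @unit_interval R) (arcs k x).
      by split; [exists y|exists x => //; rewrite unitE; lra].
    move/(arc_meet ik) => [_ [] /ki h].
      by have e' : x = 0 by [apply: h; lra]; lra.
    by have e' : x = 1 by [apply: h; lra]; lra.
  case=> -[y +] /ki h; rewrite /= in_itv/= => yI.
    by have e' : y = x by [apply: h; lra]; lra.
  by have e' : y = x by [apply: h; lra]; lra.
move=> Hp; have : [set: X] p by [].
rewrite arc_cover => -[i _ [x]]; rewrite unitE => xI xp.
have [ik|ik] := eqVneq i k; last first.
  by exfalso; apply: Hp; left; exists i; [exact/eqP|exists x => //; rewrite unitE].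
rewrite ik in xp; exists x => //=; rewrite in_itv/=.
have [xu|ux] := leP x u.
  by exfalso; apply: Hp; right; left; exists x => //=; rewrite in_itv/=; lra.
have [vx|//] := leP v x.
by exfalso; apply: Hp; right; right; exists x => //=; rewrite in_itv/=; lra.
Qed.

(** [C] leaves [C'] by [circle_not_proper]. A short piece of [C] off [C'] and off the vertices stays
    inside one open arc of the graph, where it is an open subarc; a reparametrization stretches it
    over (1/2, 1). *)
Lemma free_arc (C C' : set X) (g g' : R -> X) :
  circle_param C g -> circle_param C' g' -> C <> C' ->
  exists h : R -> X, [/\ circle_param C h, open (h @` `]1 / 2, 1[) &
    h @` `]1 / 2, 1[ `&` C' = set0].
Proof.
move=> gC gC' CC'; have [cg gE Cg] := gC.
have clC' : closed C' by apply: compact_closed => //; exact: circle_param_compact gC'.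
have [x0 x0C'] : exists x, ~ C' (g x).
  apply: contrapT => H; apply: CC'; apply: circle_not_proper hX gC gC' _ => p.
  by rewrite Cg => -[x _ <-]; apply: contrapT => H'; apply: H; exists x.
have oC' : open (g @^-1` (~` C')).
  by move/continuousP : cg; apply; exact: closed_openC.
have [d d0 dP] : exists2 d : R, 0 < d & forall x, `|x0 - x| < d -> ~ C' (g x).
  have /nbhs_ballP[d /= d0 dP] : nbhs x0 (g @^-1` (~` C')) by apply: open_nbhs_nbhs.
  by exists d.
pose d1 := Num.min d (1 / 2).
have d10 : 0 < d1 by rewrite lt_min d0; lra.
have d1d : d1 <= d by rewrite /d1 ge_min lexx.
have d1h : d1 <= 1 / 2 by rewrite /d1 ge_min lexx orbT.
pose ends := codom (arcs^~ 0) ++ codom (arcs^~ 1).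
have [|||u [v [u0 uv v0 uvP]]] := @avoid_points R X g ends (x0 - d1) (x0 + d1).
- by move=> t s /gE.
- lra.
- lra.
pose x1 := (u + v) / 2.
have [k [t1 t1I x1t1]] : exists k, exists2 t, 0 <= t <= 1 & arcs k t = g x1.
  have : [set: X] (g x1) by [].
  by rewrite arc_cover => -[k _ [t tI e]]; exists k; exists t => //;
    move: tI; rewrite /unit_interval /= in_itv.
have t1oo : 0 < t1 < 1.
  have := uvP x1; rewrite -x1t1 mem_cat negb_or => /(_ _)/andP[|e0 e1].
    by rewrite /x1; lra.
  have n0 : t1 != 0.
    by apply: contraNneq e0 => ->; exact: (codom_f (arcs^~ 0)).
  have n1 : 1 != t1.
    by apply: contraNneq e1 => <-; exact: (codom_f (arcs^~ 1)).
  by rewrite !lt_def n0 n1.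
have oU := @open_subarc k 0 1 (lexx 0) ler01 (lexx 1).
have nU : nbhs x1 (g @^-1` (arcs k @` `]0, 1[)).
  apply: open_nbhs_nbhs; split; first by move/continuousP : cg; apply.
  by exists t1; rewrite //= in_itv.
have [e e0 eP] : exists2 e : R, 0 < e & forall x, `|x1 - x| < e -> (arcs k @` `]0, 1[) (g x).
  by move/nbhs_ballP : nU => [e /= e0 eP]; exists e.
pose e1 := Num.min (e / 2) ((v - u) / 2).
have e10 : 0 < e1 by rewrite lt_min; apply/andP; split; lra.
have e1e : e1 <= e / 2 by rewrite /e1 ge_min lexx.
have e1v : e1 <= (v - u) / 2 by rewrite /e1 ge_min lexx orbT.
have [N _ NP] := near_infty_natSinv_lt (PosNum e10).
have := NP N.+1 (leqnSn N); rewrite /= -/(stair_width N); set w := stair_width N => we.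
have w0 : 0 < w by exact: stair_width_gt0.
have w1 : w <= 2^-1 by exact: stair_width_le.
(* A staircase has slope [w] on (1/2, 1), its steep piece having ended by [w <= 1 / 2]; so that
   interval is compressed to length [w / 2] ending at [x1]. *)
pose rho t := staircase N t + (x1 - 1).
have rhoE t : 1 / 2 < t < 1 -> rho t = x1 + w * (t - 1).
  move=> tI; rewrite /rho (@staircase_local _ N 0 t) -/w; last by rewrite mulr0z; lra.
  have -> : Num.min 1 (Num.max 0 ((t - 0%:~R) / w)) = 1.
    by rewrite min_l// le_max ler_pdivlMr// mulr0z; apply/orP; right; lra.
  by rewrite mulr0z; ring.
have hC : circle_param C (g \o rho).
  apply: circle_reparam gC _ _ _.
  - apply: continuousD_fun; last exact: continuous_cst.
    exact: continuous_staircase.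
  - by move=> t s ts; rewrite /rho ltrD2r staircase_lt.
  - by move=> t; rewrite /rho staircaseD1 addrAC.
have imE : (g \o rho) @` `]1 / 2, 1[ = g @` `](x1 - w / 2), x1[.
  apply/seteqP; split=> _ [t + <-]; rewrite /= in_itv/= => tI.
    by exists (rho t) => //=; rewrite in_itv/= rhoE; nra.
  have sI : 1 / 2 < (t - x1) / w + 1 < 1.
    have h1 : - (1 / 2) < (t - x1) / w by rewrite ltr_pdivlMr//; lra.
    have h2 : (t - x1) / w < 0 by rewrite ltr_pdivrMr//; lra.
    by move: h1 h2; lra.
  exists ((t - x1) / w + 1); first by rewrite /= in_itv.
  by rewrite /= rhoE// addrK mulrCA mulfV ?gt_eqF// mulr1 addrC subrK.
exists (g \o rho); split=> //; rewrite imE; last first.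
  apply/seteqP; split=> // _ [[x + <-]]; rewrite /= in_itv/= => xI.
  by apply: dP; rewrite ltr_norml; move: e1v u0 v0 w1 xI; rewrite /x1; lra.
have [g0 [_ [cg0 [_ [_ [g0K gK]]]]]] := arcP k.
have inU x : x1 - w / 2 <= x <= x1 -> (arcs k @` `]0, 1[) (g x).
  by move=> xI; apply: eP; rewrite ltr_norml; lra.
have sub01 : arcs k @` `]0, 1[ `<=` arcs k @` @unit_interval R.
  by apply: image_subset => x; rewrite /unit_interval /= !in_itv/=; lra.
have HK x : x1 - w / 2 <= x <= x1 -> arcs k (g0 (g x)) = g x.
  by move=> xI; apply: gK; apply: sub01; exact: inU.
have cH : {within `[x1 - w / 2, x1], continuous (g0 \o g)}.
  apply: (within_comp (B := arcs k @` @unit_interval R)) => //.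
    exact: continuous_subspaceT.
  by move=> x; rewrite /= in_itv/= => xI; apply: sub01; exact: inU.
have iH : {in `[x1 - w / 2, x1] &, injective (g0 \o g)}.
  move=> x y; rewrite !in_itv/= => xI yI /(congr1 (arcs k)); rewrite !HK// => /gE[q xq].
  have q1 : (-1 < q < 1)%R by rewrite -!(ltr_int R) mulrNz; lra.
  have q0 : q = 0 by move: q1; clear; lia.
  by rewrite xq q0 addr0.
have w2 : x1 - w / 2 < x1 by lra.
(* Read in the coordinate of the arc, the piece is an injective continuous image of an interval,
   hence an interval. *)
have -> : g @` `](x1 - w / 2), x1[ = arcs k @` ((g0 \o g) @` `](x1 - w / 2), x1[).
  rewrite [RHS]image_comp; apply: eq_imagel => x /=.
  by rewrite in_itv/= => xI; rewrite HK//; lra.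
rewrite injective_image_oo//; have H01 x : x1 - w / 2 <= x <= x1 -> 0 < g0 (g x) < 1.
  move=> /inU[t + <-]; rewrite /= in_itv/= => tI; rewrite g0K//.
  by rewrite /unit_interval /= in_itv/= !ltW; case/andP: tI.
have h1 : 0 < g0 (g (x1 - w / 2)) < 1 by apply: H01; lra.
have h2 : 0 < g0 (g x1) < 1 by apply: H01; lra.
apply: open_subarc => /=.
- by rewrite le_min; lra.
- by rewrite ge_min !le_max lexx.
- by rewrite ge_max; lra.
Qed.
End graph_arcs.

(** * Subgraphs as spaces of their own *)

Section subgraphs.
Context {R : realType}.

Lemma arc_param_of_inj (X : topologicalType) (f : R -> X) : hausdorff_space X ->
  {within @unit_interval R, continuous f} ->
  {in @unit_interval R &, injective f} -> is_arc_param f.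
Proof.
move=> hX cf fi; apply: (compact_inj_homeo 0 hX _ cf fi); exact: segment_compact.
Qed.

Lemma set_type_graph (X : pseudoMetricType R) (D : set X) (n : nat)
    (arcs : 'I_n -> R -> X) : hausdorff_space X -> D !=set0 ->
  (forall i, {within @unit_interval R, continuous (arcs i)}) ->
  (forall i, {in @unit_interval R &, injective (arcs i)}) ->
  D = \bigcup_(i in [set: 'I_n]) (arcs i @` @unit_interval R) ->
  (forall i j, i <> j ->
     (arcs i @` @unit_interval R) `&` (arcs j @` @unit_interval R)
       `<=` arc_endpoints (arcs i) `&` arc_endpoints (arcs j)) ->
  is_graph (set_type D).
Proof.
move=> hX [d Dd] ca ai DE meet.
have d' : set_type D by exists d; rewrite inE.
have aD i t : (@unit_interval R) t -> D (arcs i t).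
  by move=> tI; rewrite DE; exists i => //; exists t.
have aE i t : (@unit_interval R) t -> set_val (to_set_type d' (arcs i t)) = arcs i t.
  by move=> tI; rewrite to_set_typeK//; exact: aD.
have hD : hausdorff_space (set_type D) by exact: set_type_hausdorff.
have cD : compact D.
  rewrite DE -bigsetU_fset_set; last exact: finite_finset.
  apply: bigsetU_compact => i _; apply: continuous_compact (ca i) _.
  exact: segment_compact.
split=> //.
- exact: set_type_compact.
- by exists d'.
exists n, (fun i => to_set_type d' \o arcs i); split.
- move=> i; apply: arc_param_of_inj => //.
    exact: (within_comp (ca i) (aD i) (@within_continuous_to_set_type _ _ d')).
  move=> t s tI sI /(congr1 set_val) /=.
  by rewrite !aE -?(inE (mem _)) // ?inE; [exact: ai|exact/set_mem|exact/set_mem].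
- apply/seteqP; split=> // x _; have : D (set_val x) by exact: set_valP.
  rewrite [X in X _]DE => -[i _ [t tI xt]]; exists i => //; exists t => //=.
  by rewrite xt; exact: set_valK.
move=> i j ij x [[t tI xt] [s sI xs]].
have : (arcs i @` @unit_interval R `&` arcs j @` @unit_interval R) (set_val x).
  by split; [exists t => //; rewrite -xt /= aE|exists s => //; rewrite -xs /= aE].
have K k t' : set_val x = arcs k t' -> x = (to_set_type d' \o arcs k) t'.
  by move=> /= <-; rewrite set_valK.
move/(meet i j ij) => [H1 H2].
by split; [case: H1 => /K|case: H2 => /K]; [left|right|left|right].
Qed.

Lemma circle_param_set_type (X : topologicalType) (D C : set X) (g : R -> X)
    (d : set_type D) :
  circle_param C g -> C `<=` D ->
  circle_param (set_val @^-1` C : set (set_type D)) (to_set_type d \o g).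
Proof.
move=> [cg gE Cg] CD; have gD t : D (g t) by apply: CD; rewrite Cg; exists t.
split.
- exact: continuous_comp_within cg gD (@within_continuous_to_set_type _ _ d).
- move=> t s; rewrite -gE /=; split=> [/(congr1 set_val)|->//].
  by rewrite !to_set_typeK.
- apply/seteqP; split=> [x|_ [t _ <-]] /=.
    by rewrite Cg => -[t _ tx]; exists t => //=; rewrite tx set_valK.
  by rewrite to_set_typeK// Cg; exists t.
Qed.
End subgraphs.

Lemma skew_system_connected (R : realType) (G : pseudoMetricType R) (C1 C2 : set G)
    (P : forall (B G : pseudoMetricType R), set (B * G) -> Prop) :
  is_graph G -> connected [set: G] -> is_circle R C1 -> is_circle R C2 -> C1 <> C2 ->
  (forall (B : pseudoMetricType R) (b : B),
     hausdorff_space B -> P B G ([set b] `*` (C1 `|` C2))) ->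
  skew_system_exists P.
Proof.
move=> grG conG /circle_param_exists[g1 g1C] /circle_param_exists[g2 g2C] CC PB.
have [hG cG _ [n [arcs [arcP cover meet]]]] := grG.
have [h1 [h1C oJ1 J1C]] := free_arc hG arcP cover meet g1C g2C CC.
have [h2 [h2C oJ2 J2C]] := free_arc hG arcP cover meet g2C g1C (nesym CC).
apply: (@skew_system_of_circles R G (fun j => if j then C1 else C2)
  (fun j => if j then h1 else h2)) => //; by case.
Qed.

(** An arc meeting the component lies in it, so the component is the union of the arcs it
    contains. *)
Lemma component_graph (R : realType) (X : pseudoMetricType R) (p : X) :
  is_graph X -> is_graph (set_type (connected_component [set: X] p)).
Proof.
move=> [hX cX _ [n [arcs [arcP cover meet]]]].
set D := connected_component _ _.
have conarc i : connected (arcs i @` @unit_interval R).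
  apply: connected_continuous_connected; last by have [] := arc_param_inj (arcP i).
  exact/connected_intervalP/interval_is_interval.
have arcD i x : (arcs i @` @unit_interval R) x -> D x -> arcs i @` @unit_interval R `<=` D.
  move=> ix Dx y iy; apply: (connected_component_trans Dx).
  by exists (arcs i @` @unit_interval R) => //; split=> //.
pose I := [set i | `[< arcs i @` @unit_interval R `<=` D >]].
apply: (@set_type_graph R X D #|I| (fun j => arcs (enum_val j))) => //.
- by exists p; exact: connected_component_refl.
- by move=> i; have [] := arc_param_inj (arcP (enum_val i)).
- by move=> i; have [] := arc_param_inj (arcP (enum_val i)).
- apply/seteqP; split=> [x Dx|x [j _ jx]].
    have : [set: X] x by []. rewrite cover => -[i _ ix].
    have iI : i \in I by rewrite inE; apply/asboolP; exact: arcD Dx.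
    by exists (enum_rank_in iI i) => //; rewrite enum_rankK_in.
  by have := enum_valP j; rewrite inE => /asboolP; apply.
- move=> i j ij; apply: meet => /enum_val_inj; exact: ij.
Qed.

(** * A dumbbell in the plane *)

Section dumbbell.
Context {R : realType}.

(** Four half circles and a bar, all written as graphs over an interval of radius 1 about a centre;
    sign 0 flattens the half circle to the bar. *)
Definition dumbbell_center (i : 'I_5) : R := nth 0 [:: -2; -2; 0; 2; 2] i.
Definition dumbbell_sign (i : 'I_5) : R := nth 0 [:: 1; -1; 0; 1; -1] i.
Definition dumbbell_arc (i : 'I_5) (t : R) : R * R :=
  (dumbbell_center i + (2 * t - 1), dumbbell_sign i * Num.sqrt (1 - (2 * t - 1) ^+ 2)).
Definition dumbbell : set (R * R) :=
  \bigcup_(i in [set: 'I_5]) (dumbbell_arc i @` @unit_interval R).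

Lemma unit_intervalE (t : R) : (@unit_interval R) t = (0 <= t <= 1).
Proof. by rewrite /unit_interval /= in_itv. Qed.

Lemma hausdorff_plane : hausdorff_space (R * R)%type.
Proof. by apply: hausdorff_prod; exact: Rhausdorff. Qed.

Lemma continuous_dumbbell_arc i : continuous (dumbbell_arc i).
Proof.
have lin : continuous (fun t : R => 2 * t - 1).
  apply: continuousB_fun; last exact: continuous_cst.
  by apply: continuousM_fun; [exact: continuous_cst|exact: continuous_idfun].
apply: continuous_pair; first by apply: continuousD_fun lin; exact: continuous_cst.
apply: continuousM_fun; first exact: continuous_cst.
apply: (continuous_compose _ (@sqrt_continuous R)).
apply: continuousB_fun; first exact: continuous_cst.
by move=> t; apply: (continuousM_fun lin lin).
Qed.

Lemma dumbbell_arc_inj i : injective (dumbbell_arc i).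
Proof. by move=> t s [] e _; lra. Qed.

Lemma dumbbell_centers (i j : 'I_5) : i <> j ->
  (dumbbell_center i = dumbbell_center j /\ dumbbell_sign i - dumbbell_sign j != 0) \/
  (dumbbell_center i + 2 <= dumbbell_center j \/ dumbbell_center j + 2 <= dumbbell_center i).
Proof.
rewrite /dumbbell_center /dumbbell_sign.
move=> ij; have {ij} : (i <> j :> nat) by move=> e; apply: ij; exact: val_inj.
case: i => -[|[|[|[|[|//]]]]] ?; case: j => -[|[|[|[|[|//]]]]] ? /= ij //;
  first [by right; left; lra|by right; right; lra|left; split=> //; apply/eqP; lra].
Qed.

(** Arcs with a common centre have different signs and meet where the square root vanishes; other
    centres are at least 2 apart, so only extreme abscissas can agree. *)
Lemma dumbbell_arc_meet (i j : 'I_5) (t s : R) : i <> j -> 0 <= t <= 1 -> 0 <= s <= 1 ->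
  dumbbell_arc i t = dumbbell_arc j s -> (t = 0 \/ t = 1) /\ (s = 0 \/ s = 1).
Proof.
move=> ij t01 s01 [e1 e2]; have [[c sg]|[c|c]] := dumbbell_centers ij.
- have ts : t = s by lra.
  have : (dumbbell_sign i - dumbbell_sign j) * Num.sqrt (1 - (2 * t - 1) ^+ 2) = 0.
    by rewrite mulrBl e2 ts subrr.
  move/eqP; rewrite mulf_eq0 (negbTE sg) /= sqrtr_eq0 => h.
  have : t * (t - 1) = 0 by nra.
  move/eqP; rewrite mulf_eq0 -ts subr_eq0 => /orP[/eqP->|/eqP->]; first by split; left.
  by split; right.
- by split; [right|left]; lra.
- by split; [left|right]; lra.
Qed.

Lemma dumbbell_graph : is_graph (set_type dumbbell).
Proof.
apply: (@set_type_graph R (R * R)%type dumbbell 5 dumbbell_arc) => //.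
- by exists (dumbbell_arc ord0 0), ord0 => //; exists 0 => //; rewrite unit_intervalE lexx ler01.
- by move=> i; apply: continuous_subspaceT; exact: continuous_dumbbell_arc.
- by move=> i t s _ _; exact: dumbbell_arc_inj.
move=> i j ij _ [[t + <-] [s + ts]]; rewrite !unit_intervalE => tI sI.
have [t0 s0] := dumbbell_arc_meet ij tI sI (esym ts).
split; first by case: t0 => ->; [left|right].
by rewrite -ts; case: s0 => ->; [left|right].
Qed.

Lemma dumbbell_connected : connected [set: set_type dumbbell].
Proof.
apply: set_type_connected.
have conA i : connected (dumbbell_arc i @` @unit_interval R).
  apply: connected_continuous_connected.
    exact/connected_intervalP/interval_is_interval.
  by apply: continuous_subspaceT; exact: continuous_dumbbell_arc.
pose A k := dumbbell_arc (inord k) @` @unit_interval R.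
have arc_end k (b : bool) : A k (dumbbell_arc (inord k) b%:R).
  by exists b%:R => //; rewrite unit_intervalE; case: b; rewrite ?lexx ?ler01.
have sq0 : Num.sqrt (1 - (2 * 0 - 1) ^+ 2) = 0 :> R.
  by rewrite (_ : 1 - _ = 0) ?sqrtr0//; ring.
have sq1 : Num.sqrt (1 - (2 * 1 - 1) ^+ 2) = 0 :> R.
  by rewrite (_ : 1 - _ = 0) ?sqrtr0//; ring.
have arcE k (b : bool) : (k < 5)%N ->
    dumbbell_arc (inord k) b%:R = (nth 0 [:: -2; -2; 0; 2; 2] k + (if b then 1 else -1), 0).
  move=> k5; rewrite /dumbbell_arc /dumbbell_center /dumbbell_sign inordK//.
  by case: b; rewrite /= ?sq1 ?sq0 mulr0; congr (_ + _, _); ring.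
have -> : dumbbell = A 0%N `|` A 1%N `|` A 2%N `|` A 3%N `|` A 4%N.
  apply/seteqP; split=> [p [i _]|p].
    have -> : i = inord i by apply: val_inj; rewrite /= inordK.
    by case: i => -[|[|[|[|[|//]]]]] ? /= ip; [left; left; left; left|left; left; left; right
      |left; left; right|left; right|right].
  by move=> [[[[]|]|]|] Ap; [exists (inord 0)|exists (inord 1)|exists (inord 2)
    |exists (inord 3)|exists (inord 4)].
(* The arcs are removed one at a time from the right; each shares its left end with the arc of the
   preceding index. *)
apply: connectedU => //; last by exact: conA.
  exists (dumbbell_arc (inord 4) (false : bool)%:R); split; last exact: arc_end.
  by right; rewrite arcE// -(arcE 3 false)//; exact: arc_end.
apply: connectedU => //; last by exact: conA.
  exists (dumbbell_arc (inord 3) (false : bool)%:R); split; last exact: arc_end.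
  right; rewrite arcE// (_ : (_ + _, _) = dumbbell_arc (inord 2) true%:R); first exact: arc_end.
  by rewrite arcE//=; congr (_, _); ring.
apply: connectedU => //; last by exact: conA.
  exists (dumbbell_arc (inord 2) (false : bool)%:R); split; last exact: arc_end.
  right; rewrite arcE// (_ : (_ + _, _) = dumbbell_arc (inord 1) true%:R); first exact: arc_end.
  by rewrite arcE//=; congr (_, _); ring.
apply: connectedU => //; try exact: conA.
exists (dumbbell_arc (inord 1) (false : bool)%:R); split; last exact: arc_end.
by rewrite arcE// -(arcE 0 false)//; exact: arc_end.
Qed.

Definition dumbbell_loop (c t : R) : R * R := (c + (wind t).1, (wind t).2).

Lemma dumbbell_loop_param c : circle_param (range (dumbbell_loop c)) (dumbbell_loop c).
Proof.
split=> //.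
  apply: continuous_pair.
    apply: continuousD_fun; first exact: continuous_cst.
    by apply: continuous_compose continuous_wind _ => p; exact: cvg_fst.
  by apply: continuous_compose continuous_wind _ => p; exact: cvg_snd.
move=> t s; rewrite -wind_eq; split=> [[/addrI e1 e2]|].
  by rewrite [LHS]surjective_pairing [RHS]surjective_pairing /= e1 e2.
by rewrite /dumbbell_loop => ->.
Qed.

Lemma dumbbell_loop_sub (b : bool) :
  range (dumbbell_loop (if b then 2 else -2)) `<=` dumbbell.
Proof.
move=> _ [t _ <-]; have : (@unit_circle R) (wind t) by rewrite wind_range; exists t.
rewrite /dumbbell_loop; case: (wind t) => x y; rewrite /unit_circle /= => xy.
have x1 : -1 <= x <= 1 by nra.
have sE : Num.sqrt (1 - (2 * ((x + 1) / 2) - 1) ^+ 2) = `|y|.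
  by rewrite -sqrtr_sqr; congr Num.sqrt; rewrite (_ : 2 * _ - 1 = x); [lra|field].
pose k : nat := if b then (if 0 <= y then 3%N else 4%N) else (if 0 <= y then 0%N else 1%N).
exists (inord k) => //; exists ((x + 1) / 2); first by rewrite unit_intervalE; lra.
rewrite /dumbbell_arc sE /dumbbell_center /dumbbell_sign inordK; last first.
  by rewrite /k; case: (b); case: ifP.
have -> : 2 * ((x + 1) / 2) - 1 = x by field.
rewrite /k {k}; case: b; have [y0|y0] := leP 0 y => /=.
- by rewrite mul1r ger0_norm.
- by rewrite mulN1r ltr0_norm// opprK.
- by rewrite mul1r ger0_norm.
- by rewrite mulN1r ltr0_norm// opprK.
Qed.

Lemma dumbbell_circles : exists (G : pseudoMetricType R) (K1 K2 : set G),
  [/\ is_graph G, connected [set: G], is_circle R K1, is_circle R K2 & K1 `&` K2 = set0].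
Proof.
pose K (b : bool) : set (set_type dumbbell) :=
  set_val @^-1` range (dumbbell_loop (if b then 2 else -2)).
have d : set_type dumbbell.
  by exists (dumbbell_loop 2 0); rewrite inE; apply: (@dumbbell_loop_sub true); exists 0.
have KC b : is_circle R (K b).
  apply: circle_param_is_circle.
    exact: set_type_hausdorff hausdorff_plane.
  by apply: (circle_param_set_type d (dumbbell_loop_param _)); exact: dumbbell_loop_sub.
exists (set_type dumbbell), (K true), (K false); split=> //.
- exact: dumbbell_graph.
- exact: dumbbell_connected.
apply/seteqP; split=> // x [[t _ tx] [s _ sx]].
have := congr1 fst (etrans tx (esym sx)); rewrite /dumbbell_loop /wind /=.
have := cos_geN1 (2 * pi * t); have := cos_le1 (2 * pi * s); lra.
Qed.
End dumbbell.

(** * Disjoint unions and slices of circles *)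

Lemma homeomorphic_disjointU (X Y : topologicalType) (A B : set X) (A' B' : set Y) :
  closed A -> closed B -> closed A' -> closed B' ->
  A `&` B = set0 -> A' `&` B' = set0 ->
  homeomorphic A A' -> homeomorphic B B' -> homeomorphic (A `|` B) (A' `|` B').
Proof.
move=> cA cB cA' cB' AB AB' [f [g [cf [cg [fA [gA [gf fg]]]]]]].
move=> [f' [g' [cf' [cg' [fB [gB [gf' fg']]]]]]].
pose F x := if pselect (A x) then f x else f' x.
pose H y := if pselect (A' y) then g y else g' y.
have FA x : A x -> F x = f x by move=> Ax; rewrite /F; case: pselect.
have FB x : B x -> F x = f' x.
  by move=> Bx; rewrite /F; case: pselect => // Ax; have : (A `&` B) x by []; rewrite AB.
have HA y : A' y -> H y = g y by move=> Ay; rewrite /H; case: pselect.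
have HB y : B' y -> H y = g' y.
  by move=> By; rewrite /H; case: pselect => // Ay; have : (A' `&` B') y by []; rewrite AB'.
have fA' x : A x -> A' (f x) by move=> Ax; apply: fA; exists x.
have fB' x : B x -> B' (f' x) by move=> Bx; apply: fB; exists x.
have gA' y : A' y -> A (g y) by move=> Ay; apply: gA; exists y.
have gB' y : B' y -> B (g' y) by move=> By; apply: gB; exists y.
exists F, H; split.
  apply: withinU_continuous => //.
    by apply: subspace_eq_continuous cf => x; rewrite inE => /FA.
  by apply: subspace_eq_continuous cf' => x; rewrite inE => /FB.
split.
  apply: withinU_continuous => //.
    by apply: subspace_eq_continuous cg => x; rewrite inE => /HA.
  by apply: subspace_eq_continuous cg' => x; rewrite inE => /HB.
split.
  by move=> _ [x [Ax|Bx] <-]; [left; rewrite FA//; exact: fA'|right; rewrite FB//; exact: fB'].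
split.
  by move=> _ [x [Ax|Bx] <-]; [left; rewrite HA//; exact: gA'|right; rewrite HB//; exact: gB'].
split=> x [Ax|Bx].
- by rewrite FA// HA ?gf//; exact: fA'.
- by rewrite FB// HB ?gf'//; exact: fB'.
- by rewrite HA// FA ?fg//; exact: gA'.
- by rewrite HB// FB ?fg'//; exact: gB'.
Qed.

Lemma is_circle_slice (R : realType) (X Y : topologicalType) (y : Y) (C : set X) :
  hausdorff_space X -> hausdorff_space Y -> is_circle R C -> is_circle R ([set y] `*` C).
Proof.
move=> hX hY /circle_param_exists[g gC].
apply: circle_param_is_circle; first exact: hausdorff_prod.
exact: circle_param_slice gC.
Qed.

Lemma is_circle_closed (R : realType) (X : topologicalType) (C : set X) :
  hausdorff_space X -> is_circle R C -> closed C.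
Proof.
move=> hX /circle_param_exists[g gC]; apply: compact_closed => //.
exact: circle_param_compact gC.
Qed.

Lemma is_circle_homeomorphic (R : realType) (X Y : topologicalType) (C : set X) (D : set Y) :
  hausdorff_space X -> hausdorff_space Y -> is_circle R C -> is_circle R D ->
  homeomorphic C D.
Proof.
move=> hX hY /circle_param_exists[g gC] /circle_param_exists[h hD].
exact: circle_params_homeomorphic gC hD.
Qed.

Lemma setXU_slice (X Y : Type) (y : Y) (A B : set X) :
  [set y] `*` (A `|` B) = ([set y] `*` A) `|` ([set y] `*` B).
Proof.
apply/seteqP; split=> [[u v] [/= -> [Av|Bv]]|[u v] [[/= -> Av]|[/= -> Bv]]].
- by left.
- by right.
- by split=> //; left.
- by split=> //; right.
Qed.

Lemma slice_disjoint (X Y : Type) (y : Y) (A B : set X) :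
  A `&` B = set0 -> ([set y] `*` A) `&` ([set y] `*` B) = set0.
Proof.
move=> AB; apply/seteqP; split=> // -[u v] [[_ Av] [_ Bv]].
by have : (A `&` B) v by []; rewrite AB.
Qed.

Lemma homeomorphic_slice_set_val (X Y : topologicalType) (y : Y) (D C : set X) :
  C `<=` D -> D !=set0 ->
  homeomorphic ([set y] `*` (set_val @^-1` C : set (set_type D))) C.
Proof.
move=> CD [d Dd]; have d' : set_type D by exists d; rewrite inE.
exists (fun p => set_val p.2), (fun x => (y, to_set_type d' x)); split.
  apply: continuous_subspaceT; apply: (continuous_compose (f := snd)).
    by move=> p; exact: cvg_snd.
  exact: continuous_set_val.
split.
  apply: (within_comp (B := [set: set_type D]) (f := pair y)) => //.
    exact: continuous_subspaceW CD (@within_continuous_to_set_type _ _ d').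
  apply: continuous_subspaceT; apply: continuous_pair; first exact: continuous_cst.
  exact: continuous_idfun.
split; first by move=> _ [[u v] [/= _ Cv] <-].
split; first by move=> _ [x Cx <-]; split=> //=; rewrite to_set_typeK//; exact: CD.
split; first by move=> [u v] [/= -> _]; rewrite set_valK.
by move=> x Cx /=; rewrite to_set_typeK//; exact: CD.
Qed.

Theorem theoremD (R : realType) :
  (forall (X : pseudoMetricType R) (C1 C2 : set X),
     is_graph X -> is_circle R C1 -> is_circle R C2 -> C1 <> C2 ->
     @skew_system_exists R (fun B G Mb =>
       (exists D1 D2 : set (B * G)%type,
          [/\ is_circle R D1, is_circle R D2 & Mb = D1 `|` D2]) /\
       homeomorphic Mb (C1 `|` C2)))
  /\
  @skew_system_exists R (fun B G Mb =>
       exists D1 D2 : set (B * G)%type,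
          [/\ is_circle R D1, is_circle R D2, D1 `&` D2 = set0 & Mb = D1 `|` D2]).
Proof.
have [G [K1 [K2 [grG conG K1c K2c K12]]]] := @dumbbell_circles R.
have hG : hausdorff_space G by case: grG.
have K1K2 : K1 <> K2.
  move=> e; have [g [_ _ gK]] := circle_param_exists K1c.
  have : (K1 `&` K2) (g 0) by rewrite -e setIid gK; exists 0.
  by rewrite K12.
split; last first.
  apply: (skew_system_connected grG conG K1c K2c K1K2) => B b hB.
  exists ([set b] `*` K1), ([set b] `*` K2); split.
  - exact: is_circle_slice.
  - exact: is_circle_slice.
  - exact: slice_disjoint.
  - exact: setXU_slice.
move=> X C1 C2 grX C1c C2c C12; have hX : hausdorff_space X by case: grX.
(* Disjoint circles may lie in different components of [X], so the dumbbell replaces it; a disjoint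
   union of two circles is determined up to homeomorphism. *)
have [[p [C1p C2p]]|C0] := pselect (C1 `&` C2 !=set0); last first.
  apply: (skew_system_connected grG conG K1c K2c K1K2) => B b hB.
  have L1 := is_circle_slice b hG hB K1c; have L2 := is_circle_slice b hG hB K2c.
  have hBG := hausdorff_prod hB hG.
  rewrite setXU_slice; split; first by exists ([set b] `*` K1), ([set b] `*` K2).
  apply: homeomorphic_disjointU.
  - exact: is_circle_closed L1.
  - exact: is_circle_closed L2.
  - exact: is_circle_closed C1c.
  - exact: is_circle_closed C2c.
  - exact: slice_disjoint.
  - by apply/seteqP; split=> // x C1x; apply: C0; exists x.
  - exact: is_circle_homeomorphic L1 C1c.
  - exact: is_circle_homeomorphic L2 C2c.
(* Both circles are connected and contain [p], so they lie in this component, which is a connected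
   graph. *)
pose D := connected_component [set: X] p.
have CD C : is_circle R C -> C p -> C `<=` D.
  move=> /circle_param_exists[g gC] Cp x Cx; exists C => //; split=> //.
  exact: circle_param_connected gC.
have D1 := CD _ C1c C1p; have D2 := CD _ C2c C2p.
have D0 : D !=set0 by exists p; exact: D1.
have d : set_type D by exists p; rewrite inE; exact: D1.
have hD : hausdorff_space (set_type D) by exact: set_type_hausdorff.
have valC C : is_circle R C -> C `<=` D -> is_circle R (set_val @^-1` C : set (set_type D)).
  move=> /circle_param_exists[g gC] CD'; apply: circle_param_is_circle => //.
  exact: circle_param_set_type d gC CD'.
have valE C : C `<=` D -> set_val @` (set_val @^-1` C : set (set_type D)) = C.
  move=> CD'; apply/seteqP; split=> [_ [x Cx <-]//|x Cx].
  by exists (to_set_type d x); rewrite /= to_set_typeK//; exact: CD'.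
apply: (skew_system_connected (component_graph p grX) _ (valC _ C1c D1) (valC _ C2c D2)).
- exact/set_type_connected/component_connected.
- by move=> e; apply: C12; rewrite -(valE _ D1) -(valE _ D2) e.
move=> B b hB; split; last first.
  by rewrite -preimage_setU; apply: homeomorphic_slice_set_val => // x [/D1|/D2].
exists ([set b] `*` (set_val @^-1` C1)), ([set b] `*` (set_val @^-1` C2)); split.
- by apply: is_circle_slice => //; exact: valC.
- by apply: is_circle_slice => //; exact: valC.
- exact: setXU_slice.
Qed.
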